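(* Let $c=(5,3,3,3,2,2,2,1,1,\dots,1)\in\mathbb N^{24}$ (seventeen entries equal to $1$). Then the projective algebraic set $[A_c\setminus\{0\}]\subseteq\mathbb P^{23}(\mathbb C)$ contains the two projective lines $\mathcal F_1$ and $\mathcal F_2$, where $\mathcal F_1$ is the line of points $$\begin{aligned}\mathcal F_1(\alpha,\beta)=(&\beta,\ 2\beta,\ \beta+\alpha,\ \beta-\alpha,\ 2\beta+\alpha,\ 2\alpha,\ \alpha,\ 4\beta,\ 3\beta+2\alpha,\ 3\beta+\alpha,\ 3\beta,\ 3\beta-\alpha,\ 2\beta+2\alpha,\\ &2\beta,\ 2\beta-\alpha,\ 2\beta-2\alpha,\ \beta+2\alpha,\ \beta+\alpha,\ \beta,\ \beta-\alpha,\ \beta-2\alpha,\ \alpha,\ 0,\ 0)\end{aligned}$$ and $\mathcal F_2$ is the line of points $$\begin{aligned}\mathcal F_2(\alpha,\beta)=(&\beta,\ \alpha+\beta,\ \alpha,\ \alpha-\beta,\ \alpha+2\beta,\ \alpha-2\beta,\ 2\beta,\ 2\alpha,\ 2\alpha+2\beta,\ 2\alpha+\beta,\ 2\alpha-\beta,\ 2\alpha-2\beta,\ \alpha+3\beta,\\ &\alpha+\beta,\ \alpha,\ 4\beta,\ \alpha-\beta,\ 3\beta,\ 2\beta,\ \alpha-3\beta,\ \beta,\ \beta,\ 0,\ 0).\end{aligned}$$ That is, $\mathcal F_1(\alpha,\beta)\in A_c$ and $\mathcal F_2(\alpha,\beta)\in A_c$ for all $\alpha,\beta$.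
   Context: $\mathbb N=\{1,2,3,\dots\}$. For $c\in\mathbb N^{24}$ with $\prod_{j=1}^{24}c_j=1080$, $A_c\subseteq\mathbb C^{24}$ is the set of $d\in\mathbb C^{24}$ for which the following equality of formal power series in $z$ holds, where $\zeta(1-2n)$ is the value of the Riemann zeta function: $$\exp\Big(\sum_{n\in\mathbb N}\tfrac{(-1)^n}{(2n)!}\zeta(1-2n)\sum_{j=1}^{24}(1-c_j^{2n})d_j^{2n}z^{2n}\Big)=1+\tfrac1{540}\sum_{n\in\mathbb N}\tfrac{(-1)^n}{(2n)!}\Big(\sum_{1\le i<j\le24}\big[(d_i+d_j)^{2n}+(d_i-d_j)^{2n}\big]-\sum_{j=1}^{24}d_j^{2n}\Big)z^{2n}.$$ Comparing coefficients, $A_c$ is cut out by homogeneous polynomials, so $[A_c\setminus\{0\}]$, the set of classes of nonzero points of $A_c$, is a projective algebraic set in $\mathbb P^{23}(\mathbb C)$. The parameters $\alpha,\beta$ range over $\mathbb C$. *)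

(* Defs.v *)
From HB Require Import structures.
From mathcomp Require Import all_boot all_order all_algebra.
From mathcomp Require Import complex.
From mathcomp Require Import all_classical all_reals all_analysis.

Set Implicit Arguments.
Unset Strict Implicit.
Unset Printing Implicit Defensive.

Import Order.TTheory GRing.Theory Num.Theory.
Import numFieldNormedType.Exports.

Local Open Scope classical_set_scope.
Local Open Scope ring_scope.
Local Open Scope complex_scope.

Definition Cexp (R : realType) (z : R[i]) : R[i] :=
  (expR (complex.Re z))%:C * (cos (complex.Im z) +i* sin (complex.Im z)).

(* [f] is given near [s0] by a convergent power series in [s - s0]. The norm
   topology on R[i] is available through the alias R[i]^o. *)
Definition analytic_at (R : realType) (f : R[i] -> R[i]) (s0 : R[i]) : Prop :=
  exists a : nat -> R[i], \forall s \near (s0 : R[i]^o),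
    [series a k * (s - s0) ^+ k : R[i]^o]_k @ \oo --> (f s : R[i]^o).

(* The Riemann zeta function: the analytic continuation to C \ {1} of the
   Dirichlet series \sum_(n >= 1) n^-s, Re s > 1, where n^-s is
   exp (- s ln n). By the identity theorem this determines [zeta] on C \ {1};
   its value at the pole 1 is left unconstrained. *)
Definition is_riemann_zeta (R : realType) (zeta : R[i] -> R[i]) : Prop :=
  (forall s, s != 1 -> analytic_at zeta s) /\
  (forall s, 1 < complex.Re s ->
     [series Cexp (- s * (ln n.+1%:R)%:C) : R[i]^o]_n @ \oo
       --> (zeta s : R[i]^o)).

(* Formal power series in z are represented by their coefficient sequences;
   this is the series \sum_(n >= 1) u n * z ^ (2 n). *)
Definition even_fps (K : fieldType) (u : nat -> K) (m : nat) : K :=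
  if odd m || (m == 0)%N then 0 else u m./2.

(* Formal exponential of a series [F] with zero constant term. As F^k is
   divisible by z^k, only the k <= m contribute to the coefficient of z^m in
   \sum_k F^k / k!, and F may be truncated after z^m. *)
Definition fps_exp (K : fieldType) (F : nat -> K) (m : nat) : K :=
  (\sum_(k < m.+1) (k`!%:R)^-1 *: (\poly_(i < m.+1) F i) ^+ k)`_m.

Definition A_ (R : realType) (zeta : R[i] -> R[i]) (c : 24.-tuple nat)
    : set 'rV[R[i]]_24 :=
  [set d : 'rV[R[i]]_24 | fps_exp (even_fps (fun n =>
             (-1) ^+ n / (n.*2)`!%:R * zeta (1 - (n.*2)%:R) *
             \sum_(j < 24) (1 - (tnth c j)%:R ^+ n.*2) * d 0 j ^+ n.*2))
           =1
           (fun m => (m == 0%N)%:R + 540%:R^-1 * even_fps (fun n =>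
             (-1) ^+ n / (n.*2)`!%:R *
             (\sum_(i < 24) \sum_(j < 24 | (i < j)%N)
                ((d 0 i + d 0 j) ^+ n.*2 + (d 0 i - d 0 j) ^+ n.*2)
              - \sum_(j < 24) d 0 j ^+ n.*2)) m)].

(* [S \ {0}], the set of classes of nonzero points of [S], the points
   of the projective space of V being the lines <[v]> through the origin. *)
Definition proj_set (K : fieldType) (V : vectType K) (S : set V)
    : set {vspace V} :=
  [set <[v]>%VS | v in S `\ 0].

Definition is_proj_line (K : fieldType) (V : vectType K)
    (L : set {vspace V}) : Prop :=
  exists2 U : {vspace V}, \dim U = 2%N &
    L = proj_set [set v | v \in U].

Definition c0 : 24.-tuple nat :=
  [tuple of [:: 5; 3; 3; 3; 2; 2; 2] ++ nseq 17 1]%N.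

Definition F1 (R : realType) (a b : R[i]) : 'rV[R[i]]_24 :=
  \row_(j < 24)
    [:: b; 2 * b; b + a; b - a; 2 * b + a; 2 * a; a; 4 * b; 3 * b + 2 * a;
        3 * b + a; 3 * b; 3 * b - a; 2 * b + 2 * a;
        2 * b; 2 * b - a; 2 * b - 2 * a; b + 2 * a; b + a; b; b - a;
        b - 2 * a; a; 0; 0]`_j.

Definition F2 (R : realType) (a b : R[i]) : 'rV[R[i]]_24 :=
  \row_(j < 24)
    [:: b; a + b; a; a - b; a + 2 * b; a - 2 * b; 2 * b; 2 * a; 2 * a + 2 * b;
        2 * a + b; 2 * a - b; 2 * a - 2 * b; a + 3 * b;
        a + b; a; 4 * b; a - b; 3 * b; 2 * b; a - 3 * b; b; b; 0; 0]`_j.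

(* The set of projective points of a family parametrised by (alpha, beta). *)
Definition proj_family (R : realType)
    (F : R[i] -> R[i] -> 'rV[R[i]]_24) : set {vspace 'rV[R[i]]_24} :=
  proj_set [set F p.1 p.2 | p in [set: R[i] * R[i]]].

(* Main.v *)
Require Import Defs.
From mathcomp Require Import all_boot all_order all_algebra.
From mathcomp Require Import complex.
From mathcomp Require Import all_classical all_reals all_analysis.
From HB Require Import structures.
From mathcomp Require Import ring lra zify.

Set Implicit Arguments.
Unset Strict Implicit.
Unset Printing Implicit Defensive.

Import Order.TTheory GRing.Theory Num.Theory.
Import numFieldNormedType.Exports.

Local Open Scope classical_set_scope.
Local Open Scope ring_scope.
Local Open Scope complex_scope.

(** Both parts of the argument turn on the odd zeta values. Write
    Z(w) for the even series with coefficients zeta(1-2n) w^(2n) / (2n)!. The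
    values zeta(1-2n) satisfy the recurrence [zeta_recurrence], which says
    exactly that exp Z(w) = (wz/2) / sinh(wz/2). With w_j = i d_j the left
    hand side of the equation defining A_c is therefore
      1/1080 * prod_j sinh(c_j w_j z/2) / sinh(w_j z/2),
    because the product of the c_j is 1080 ([prod_sinh_quot_exp]). Each factor
    is a finite sum of exponentials, so for d = F(alpha, beta) the product is a
    Laurent polynomial in x = exp(i alpha z/2) and y = exp(i beta z/2). With
    u_j = 2 cosh(w_j z), 1080 times the right hand side is
      24 + sum_(i<j) u_i u_j - sum_j u_j,
    again a Laurent polynomial ([theta_exp]). What remains is, for each of the
    two families, one identity between Laurent polynomials with integer
    coefficients ([half_exp1_identity], [half_exp2_identity]), which
    normalisation decides.

    The recurrence has to be drawn from the definition of zeta as an analytic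
    continuation. For Re s > 2 the sum over n >= 2 of
    (n+1)^(1-s) - (n-1)^(1-s) telescopes to -(1 + 2^(1-s)). Subtracting from
    each term its Taylor polynomial in 1/n, of which only the odd terms
    survive, produces a finite combination of the zeta(s+k-1) - 1 with
    polynomial coefficients, and a remainder [zeta_rem] ([zeta_rem_zeta]). By
    Taylor's bound in the space of power series with summable coefficients,
    the remainder is a sum of power series that converges well to the left of
    Re s = 1 ([zeta_rem_ana]). The resulting relation between values of zeta
    propagates along the segment from 3 + i to 1 - 2n ([ana_segment]), which
    meets the real axis only at its endpoint and so avoids the poles; the one
    term with a pole at 1 - 2n is first replaced by the continuation
    [zeta_reg] of (s-1)(zeta s - 1). At s = 1 - 2n every term of the remainder
    vanishes by the binomial theorem, and the recurrence is left. *)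

(** * Formal power series *)

(** The wrapper keeps the Cauchy product apart from the pointwise ring
    structure that functions already carry. *)
Record fps (K : fieldType) := Fps { fcoef : nat -> K }.

Local Notation "f _[ n ]" := (fcoef f n) (at level 3, format "f _[ n ]").

Section FormalPowerSeries.
Variable K : fieldType.
Local Notation fps := (fps K).
Implicit Types (f g h : fps) (p q : {poly K}) (m n : nat).

Lemma fpsP f g : (forall n, f _[n] = g _[n]) -> f = g.
Proof. by case: f g => [f] [g] /= fg; congr Fps; apply/funext. Qed.

HB.instance Definition _ := gen_eqMixin fps.
HB.instance Definition _ := gen_choiceMixin fps.

Definition fps_add f g := Fps (fun n => f _[n] + g _[n]).
Definition fps_opp f := Fps (fun n => - f _[n]).

Fact fps_addA : associative fps_add.
Proof. by move=> f g h; apply: fpsP => n /=; rewrite addrA. Qed.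
Fact fps_addC : commutative fps_add.
Proof. by move=> f g; apply: fpsP => n /=; rewrite addrC. Qed.
Fact fps_add0 : left_id (Fps (fun=> 0)) fps_add.
Proof. by move=> f; apply: fpsP => n /=; rewrite add0r. Qed.
Fact fps_addN : left_inverse (Fps (fun=> 0)) fps_opp fps_add.
Proof. by move=> f; apply: fpsP => n /=; rewrite addNr. Qed.

HB.instance Definition _ := GRing.isZmodule.Build fps
  fps_addA fps_addC fps_add0 fps_addN.

Definition fps_mul f g :=
  Fps (fun n => \sum_(j < n.+1) f _[j] * g _[(n - j)%N]).

Definition ptrunc m f : {poly K} := \poly_(i < m.+1) f _[i].

(** Coefficients up to a given order depend only on coefficients up to that
    order; comparing series with polynomials in this sense transports the ring
    axioms from polynomials to series. *)
Definition agree m p f := forall i, (i <= m)%N -> p`_i = f _[i].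

Lemma agree_ptrunc m f : agree m (ptrunc m f) f.
Proof. by move=> i im; rewrite coef_poly ltnS im. Qed.

Lemma agreeM m p q f g :
  agree m p f -> agree m q g -> agree m (p * q) (fps_mul f g).
Proof.
move=> pf qg i im; rewrite coefM; apply: eq_bigr => j _.
by rewrite pf ?qg // (leq_trans _ im) ?leq_subr // -ltnS.
Qed.

Definition fps_one := Fps (fun n => (n == 0)%:R : K).

Lemma agree1 m : agree m 1 fps_one.
Proof. by move=> i _; rewrite coef1. Qed.

Lemma agree_inj m p f g : agree m p f -> agree m p g -> f _[m] = g _[m].
Proof. by move=> pf pg; rewrite -pf // pg. Qed.

Lemma agreeD m p q f g : agree m p f -> agree m q g -> agree m (p + q) (f + g).
Proof. by move=> pf qg i im; rewrite coefD pf ?qg. Qed.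

Fact fps_mulA : associative fps_mul.
Proof.
move=> f g h; apply: fpsP => m; have T := @agree_ptrunc m.
apply: (@agree_inj m (ptrunc m f * (ptrunc m g * ptrunc m h))).
  by do !apply: agreeM.
by rewrite mulrA; do !apply: agreeM.
Qed.
Fact fps_mulC : commutative fps_mul.
Proof.
move=> f g; apply: fpsP => m; have T := @agree_ptrunc m.
apply: (@agree_inj m (ptrunc m f * ptrunc m g)); first exact: agreeM.
by rewrite mulrC; apply: agreeM.
Qed.
Fact fps_mul1 : left_id fps_one fps_mul.
Proof.
move=> f; apply: fpsP => m; have T := @agree_ptrunc m.
apply: (@agree_inj m (1 * ptrunc m f)); first by apply: agreeM => //; apply: agree1.
by rewrite mul1r.
Qed.
Fact fps_mulDl : left_distributive fps_mul fps_add.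
Proof.
move=> f g h; apply: fpsP => m; have T := @agree_ptrunc m.
apply: (@agree_inj m ((ptrunc m f + ptrunc m g) * ptrunc m h)).
  by apply: agreeM => //; apply: agreeD.
by rewrite mulrDl; apply: agreeD; apply: agreeM.
Qed.
Fact fps_one_neq0 : fps_one != 0.
Proof.
by apply/eqP => /(congr1 (fun f => f _[0])) /= /eqP; rewrite oner_eq0.
Qed.

HB.instance Definition _ := GRing.Zmodule_isComNzRing.Build fps
  fps_mulA fps_mulC fps_mul1 fps_mulDl fps_one_neq0.

Lemma fcoefD f g n : (f + g) _[n] = f _[n] + g _[n]. Proof. by []. Qed.
Lemma fcoefN f n : (- f) _[n] = - f _[n]. Proof. by []. Qed.
Lemma fcoef0 n : (0 : fps) _[n] = 0. Proof. by []. Qed.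
Lemma fcoef1 n : (1 : fps) _[n] = (n == 0)%:R. Proof. by []. Qed.
Lemma fcoefM f g n :
  (f * g) _[n] = \sum_(j < n.+1) f _[j] * g _[(n - j)%N].
Proof. by []. Qed.
Lemma fcoefMn f k n : (f *+ k) _[n] = f _[n] *+ k.
Proof. by elim: k => [|k IH]; rewrite ?mulr0n // !mulrS fcoefD IH. Qed.
Lemma fcoef_sum (I : Type) (r : seq I) (P : pred I) (F : I -> fps) n :
  (\sum_(i <- r | P i) F i) _[n] = \sum_(i <- r | P i) (F i) _[n].
Proof. by elim/big_rec2: _ => // i x f _ <-. Qed.
Lemma fcoefM0 f g : (f * g) _[0] = f _[0] * g _[0].
Proof. by rewrite fcoefM big_ord_recl big_ord0 addr0. Qed.

Lemma agreeX m p f k : agree m p f -> agree m (p ^+ k) (f ^+ k).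
Proof.
by move=> pf; elim: k => [|k IH]; [exact: agree1 | rewrite !exprS; apply: agreeM].
Qed.

Lemma fcoefX_lt f k n : f _[0] = 0 -> (n < k)%N -> (f ^+ k) _[n] = 0.
Proof.
move=> f0; elim: k n => // k IH n nk; rewrite exprS fcoefM big1 // => j _.
case: j => -[|j] jn /=; first by rewrite f0 mul0r.
by rewrite IH ?mulr0 //; lia.
Qed.

(** The lowest coefficient of the product comes from the lowest ones of its
    factors, so a series of finite order is not a zero divisor. *)
Lemma fps_regular (k : nat) f g :
  (forall i, (i < k)%N -> g _[i] = 0) -> g _[k] != 0 -> f * g = 0 -> f = 0.
Proof.
move=> glt gk fg; apply: fpsP; elim/ltn_ind => n IH.
have /eqP := congr1 (fun h => h _[(n + k)%N]) fg.
have nk : (n < (n + k).+1)%N by lia.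
rewrite fcoefM (bigD1 (Ordinal nk)) //= big1 => [|j jn].
  by rewrite addr0 addKn mulf_eq0 (negbTE gk) orbF => /eqP.
have [jltn|] := ltnP j n; first by rewrite IH // fcoef0 mul0r.
rewrite leq_eqVlt => /orP[/eqP nj|nj].
  by case/eqP: jn; apply: val_inj => /=.
by rewrite glt ?mulr0 //; have := ltn_ord j; lia.
Qed.

Definition fpsC (a : K) : fps := Fps (fun n => a *+ (n == 0)).

Lemma fcoefCM a f n : (fpsC a * f) _[n] = a * f _[n].
Proof.
rewrite fcoefM big_ord_recl big1 /= => [|j _]; first by rewrite mulr1n addr0 subn0.
by rewrite mulr0n mul0r.
Qed.

Lemma fpsC_nat k : fpsC k%:R = k%:R.
Proof. by apply: fpsP => n; rewrite fcoefMn fcoef1 /= mulrb; case: n => //=; rewrite mul0rn. Qed.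

Lemma fpsCM a b : fpsC (a * b) = fpsC a * fpsC b.
Proof. by apply: fpsP => n; rewrite fcoefCM /= mulrnAr. Qed.

Definition fpsX : fps := Fps (fun n => (n == 1)%:R).

Lemma fcoefXM f n : (fpsX * f) _[n.+1] = f _[n].
Proof.
rewrite fcoefM 2!big_ord_recl big1 /= => [|j _]; last by rewrite mul0r.
by rewrite mul0r add0r mul1r addr0 subSS subn0.
Qed.

Lemma fcoefXM0 f : (fpsX * f) _[0] = 0.
Proof. by rewrite fcoefM0 mul0r. Qed.

(** The derivation z d/dz. Unlike d/dz it does not shift coefficients, so no
    order is lost in the differential equations below. *)
Definition euler f := Fps (fun n => n%:R * f _[n]).

Lemma eulerD f g : euler (f + g) = euler f + euler g.
Proof. by apply: fpsP => n /=; rewrite mulrDr. Qed.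

Lemma eulerN f : euler (- f) = - euler f.
Proof. by apply: fpsP => n /=; rewrite mulrN. Qed.

Lemma eulerM f g : euler (f * g) = euler f * g + f * euler g.
Proof.
apply: fpsP => n; rewrite /= mulr_sumr -big_split /=; apply: eq_bigr => j _.
have -> : n%:R = j%:R + (n - j)%:R :> K by rewrite -natrD subnKC // -ltnS.
by ring.
Qed.

Lemma euler1 : euler 1 = 0.
Proof. by apply: fpsP => -[|n] /=; rewrite ?mul0r ?mulr0. Qed.

Lemma eulerX f k : euler (f ^+ k) = (f ^+ k.-1 * euler f) *+ k.
Proof.
elim: k => [|k IH]; first by rewrite euler1.
rewrite exprS eulerM IH mulrS [in RHS]mulrC mulrnAr /=; congr (_ + _).
by case: k {IH} => [|k]; rewrite ?mulr0n // mulrA -exprS mulrC.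
Qed.

Lemma euler_prod (I : Type) (r : seq I) (F G : I -> fps) :
  (forall i, euler (F i) = G i * F i) ->
  euler (\prod_(i <- r) F i) = (\sum_(i <- r) G i) * \prod_(i <- r) F i.
Proof.
move=> FG; elim: r => [|i r IH]; first by rewrite !big_nil euler1 mul0r.
by rewrite !big_cons eulerM IH FG; ring.
Qed.

Hypothesis char0 : forall n, n.+1%:R != 0 :> K.

(** The n-th coefficient of the equation determines n times the n-th
    coefficient of a solution from the previous ones. *)
Lemma euler_uniq f g h : euler g = f * g -> euler h = f * h -> f _[0] = 0 ->
  g _[0] = h _[0] -> g = h.
Proof.
move=> eg eh f0 gh0; apply: fpsP; elim/ltn_ind => -[_ //|n IH].
apply: (mulfI (char0 n)).
rewrite -[LHS]/((euler g) _[n.+1]) -[RHS]/((euler h) _[n.+1]) eg eh !fcoefM.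
apply: eq_bigr => -[[|j] jn] _ /=; first by rewrite f0 !mul0r.
by rewrite IH //; lia.
Qed.

(** The truncations in the definition of the formal exponential do not
    affect the coefficient that is read off. *)
Lemma fps_expE (F : nat -> K) m : fps_exp F m =
  \sum_(k < m.+1) (k`!%:R)^-1 * (Fps F ^+ k) _[m].
Proof.
rewrite /fps_exp coef_sum; apply: eq_bigr => k _; rewrite coefZ; congr (_ * _).
by apply: (agreeX k (@agree_ptrunc m (Fps F))).
Qed.

(** The formal exponential is characterised by the differential equation of
    exp F. The terms F^k with k > m do not reach order m, which makes the
    truncation depth irrelevant. *)
Lemma euler_fps_exp (F : nat -> K) : F 0 = 0 ->
  euler (Fps (fps_exp F)) = euler (Fps F) * Fps (fps_exp F).
Proof.
move=> F0; apply: fpsP => m.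
(* F^k has no coefficient of order i for k > i, so all orders i <= m can use
   the same m + 1 summands. *)
have expW i : (i <= m)%N -> fps_exp F i =
    \sum_(k < m) (k`!%:R)^-1 * (Fps F ^+ k) _[i] + (m`!%:R)^-1 * (Fps F ^+ m) _[i].
  move=> im; transitivity (\sum_(k < m.+1) (k`!%:R)^-1 * (Fps F ^+ k) _[i]).
    2: by rewrite big_ord_recr.
  rewrite fps_expE (big_ord_widen m.+1 (fun k => (k`!%:R)^-1 * (Fps F ^+ k) _[i])) //.
  rewrite big_mkcond; apply: eq_bigr => k _; case: ltnP => // ki.
  by rewrite fcoefX_lt ?mulr0.
rewrite [LHS]/= fps_expE mulr_sumr.
transitivity (\sum_(k < m) (k`!%:R)^-1 * (euler (Fps F) * Fps F ^+ k) _[m]).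
  have -> : \sum_(k < m.+1) m%:R * ((k`!%:R)^-1 * (Fps F ^+ k) _[m]) =
      \sum_(k < m.+1) (k`!%:R)^-1 * (euler (Fps F ^+ k)) _[m].
    by apply: eq_bigr => k _ /=; rewrite mulrCA.
  rewrite big_ord_recl expr0 euler1 mulr0 add0r; apply: eq_bigr => k _.
  rewrite lift0 eulerX fcoefMn factS natrM invfM [euler _ * _]mulrC.
  by rewrite -[X in _ * X]mulr_natl mulrACA mulVf ?char0 // mul1r [k.+1.-1]/=.
rewrite fcoefM; under eq_bigr do rewrite fcoefM mulr_sumr.
rewrite exchange_big /=; apply: eq_bigr => j _.
case: j => -[|j] jm /=; first by rewrite !mul0r big1 // => k _; rewrite !mul0r mulr0.
(* the constant term of euler F is zero, so only orders below m remain here,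
   and there the last summand vanishes *)
rewrite expW ?leq_subr // fcoefX_lt ?mulr0 ?addr0 ?mulr_sumr; last by lia.
by apply: eq_bigr => k _; rewrite mulrCA.
by [].
Qed.

Lemma fps_exp0 (F : nat -> K) : fps_exp F 0 = 1.
Proof. by rewrite fps_expE big_ord_recl big_ord0 expr0 invr1 mulr1 addr0. Qed.

(** The formal power series exp(w z). *)
Definition fexp (w : K) : fps := Fps (fun n => w ^+ n / n`!%:R).

Lemma euler_fexp w : euler (fexp w) = fpsC w * fpsX * fexp w.
Proof.
apply: fpsP => -[|n]; rewrite -mulrA fcoefCM ?fcoefXM0 ?fcoefXM /=.
  by rewrite mul0r mulr0.
by rewrite factS natrM invfM mulrCA mulVKf // exprS mulrA.
Qed.

Lemma fexp0 : fexp 0 = 1.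
Proof. by apply: fpsP => -[|n] /=; rewrite ?expr0 ?invr1 ?mulr1 // expr0n /= mul0r. Qed.

Lemma fcoef_fexp0 w : (fexp w) _[0] = 1.
Proof. by rewrite /= expr0 invr1 mulr1. Qed.

Lemma fpsCD a b : fpsC (a + b) = fpsC a + fpsC b.
Proof. by apply: fpsP => n /=; rewrite mulrnDl. Qed.

(** Both sides solve the same first order equation. *)
Lemma fexpD a b : fexp (a + b) = fexp a * fexp b.
Proof.
apply: (@euler_uniq (fpsC (a + b) * fpsX)).
- exact: euler_fexp.
- by rewrite eulerM !euler_fexp fpsCD; ring.
- by rewrite mulrC fcoefXM0.
- by rewrite fcoefM0 !fcoef_fexp0 mulr1.
Qed.

End FormalPowerSeries.

(** * Quotients of hyperbolic sines as exponentials of zeta values *)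

Section ThetaBlock.
Variable K : fieldType.
Hypothesis char0 : forall n, n.+1%:R != 0 :> K.
Variable zv : nat -> K.
Hypothesis zv_rec : forall n, (0 < n)%N ->
  \sum_(k < n) zv k.+1 / ((k.*2.+1)`!%:R * ((n - k).*2.-1)`!%:R) =
  (n.*2.+1)`!%:R^-1 - (2 * (n.*2)`!%:R)^-1.

(** With zv n standing for zeta(1-2n), this is z d/dz of the series Z(w), and
    the recurrence makes it z d/dz of log ((wz/2) / sinh(wz/2)). *)
Definition euler_log_sinh (w : K) : fps K :=
  Fps (even_fps (fun n => zv n / (n.*2.-1)`!%:R * w ^+ n.*2)).

Lemma big_even (F : nat -> K) m :
  \sum_(j < m) (if odd j then 0 else F j) = \sum_(k < uphalf m) F k.*2.
Proof.
elim: m => [|m IH]; first by rewrite !big_ord0.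
rewrite big_ord_recr /= IH uphalf_half.
case: ifP => om; first by rewrite addr0.
by rewrite add0n big_ord_recr /= even_halfK ?om.
Qed.

Lemma even_fps_mul (u : nat -> K) (s : fps K) m :
  (Fps (even_fps u) * s) _[m] =
  \sum_(k < m./2) u k.+1 * s _[(m - k.+1.*2)%N].
Proof.
transitivity (\sum_(j < m.+1) (if odd j then 0 else
    (if j == 0%N :> nat then 0 else u j./2) * s _[(m - j)%N])).
  rewrite fcoefM; apply: eq_bigr => j _ /=; rewrite /even_fps.
  by case: odd => //=; rewrite mul0r.
rewrite (big_even (fun j => (if j == 0%N then 0 else u j./2) * s _[(m - j)%N])) /=.
rewrite big_ord_recl mul0r add0r; apply: eq_bigr => k _.
by rewrite lift0 doubleS /= doubleK.
Qed.

(** The coefficient of z^(2n+1) is the recurrence for zv. The equation says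
    2 sinh(wz) L = 2 sinh(wz) - wz (1 + cosh(wz)); its half-angle form follows
    by cancelling 2 cosh(wz/2). *)
Lemma euler_log_sinh_sinh w : (fexp w - fexp (- w)) * euler_log_sinh w =
  (fexp w - fexp (- w)) - fpsC w * fpsX K * (1 + fpsC 2^-1 * (fexp w + fexp (- w))).
Proof.
have n2 : 2 != 0 :> K := char0 1.
have fN n : n`!%:R != 0 :> K by case: n`! (fact_gt0 n) => // k _.
have S n : (fexp w - fexp (- w)) _[n] = (if odd n then 2 else 0) * (w ^+ n / n`!%:R).
  rewrite fcoefD fcoefN /= exprNn.
  by rewrite -[(-1) ^+ n]signr_odd; case: odd; rewrite ?expr1 ?expr0; ring.
have C n : (fexp w + fexp (- w)) _[n] = (if odd n then 0 else 2) * (w ^+ n / n`!%:R).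
  rewrite fcoefD /= exprNn.
  by rewrite -[(-1) ^+ n]signr_odd; case: odd; rewrite ?expr1 ?expr0; ring.
apply: fpsP => m; rewrite mulrC even_fps_mul.
rewrite fcoefD fcoefN -mulrA fcoefCM S; under eq_bigr do rewrite S.
case: m => [|m].
  by rewrite big_ord0 fcoefXM0 mulr0 mul0r subr0.
rewrite fcoefXM fcoefD fcoefCM C fcoef1.
have [om|em] := boolP (odd m); last first.
  have := odd_double_half m; rewrite (negbTE em) add0n /=.
  set n := m./2 => <-.
  have [->|n0] := posnP n.
    rewrite big_ord0 /= expr1 expr0 fact0 (_ : (0.*2.+1)`! = 1%N) //; field.
    by rewrite ?n2 ?oner_eq0.
  rewrite gtn_eqF ?double_gt0 // mulr0n add0r uphalf_double.
  transitivity (2 * w ^+ n.*2.+1 *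
    \sum_(k < n) zv k.+1 / ((k.*2.+1)`!%:R * ((n - k).*2.-1)`!%:R)).
    rewrite mulr_sumr; apply: eq_bigr => k _.
    have kn := ltn_ord k.
    have -> : (n.*2.+1 - k.+1.*2 = (n - k).*2.-1)%N by lia.
    have -> : odd ((n - k).*2.-1) by rewrite -[odd _]negbK -oddS; lia.
    rewrite doubleS /=.
    have -> : n.*2.+1 = ((n - k).*2.-1 + k.*2.+2)%N by lia.
    rewrite exprD; field; by rewrite !fN.
  rewrite zv_rec // exprS odd_double; field.
  by rewrite n2 !fN.
rewrite /= om big1 /= => [|k _].
  by case: (m) om => //= m' _; rewrite !mul0r mulr0 addr0 mulr0 subr0.
have -> : odd (m.+1 - k.+1.*2) = false by have := ltn_ord k; lia.
by rewrite mul0r mulr0.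
Qed.

Lemma fexp_regular h (f : fps K) : f * (fexp h + fexp (- h)) = 0 -> f = 0.
Proof.
apply: (@fps_regular _ 0) => //.
by rewrite fcoefD !fcoef_fexp0 -mulr2n char0.
Qed.

Lemma fexp_sub_regular h (f : fps K) : h != 0 -> f * (fexp h - fexp (- h)) = 0 -> f = 0.
Proof.
move=> h0; apply: (@fps_regular _ 1) => [[|//] _|].
  by rewrite fcoefD fcoefN !fcoef_fexp0 subrr.
rewrite fcoefD fcoefN /= !expr1 !divr1 opprK -mulr2n -mulr_natl.
by rewrite mulf_neq0 // (char0 1).
Qed.

Lemma fexpN h : fexp h * fexp (- h) = 1 :> fps K.
Proof. by rewrite -fexpD // subrr fexp0. Qed.

Lemma fpsC2 : fpsC 2^-1 * 2 = 1 :> fps K.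
Proof. by rewrite -fpsC_nat -fpsCM mulVf ?(char0 1) // (fpsC_nat _ 1). Qed.

Lemma euler_log_sinh_half h : (fexp h - fexp (- h)) * euler_log_sinh (2 * h) =
  (fexp h - fexp (- h)) - fpsC h * fpsX K * (fexp h + fexp (- h)).
Proof.
apply/eqP; rewrite -subr_eq0; apply/eqP; apply: (@fexp_regular h).
have := euler_log_sinh_sinh (2 * h).
have -> : - (2 * h) = - h + - h by ring.
have -> : fexp (2 * h) = fexp h * fexp h by rewrite -fexpD //; congr fexp; ring.
rewrite fexpD // fpsCM fpsC_nat => H.
have := fexpN h; set p := fexp h in H *; set q := fexp (- h) in H *.
set c := fpsC 2^-1 in H; have c2 : c * 2 = 1 := fpsC2.
move=> pq.
transitivity ((p * p - q * q) * euler_log_sinh (2 * h) - ((p * p - q * q) - fpsC h * fpsX K * (p + q) ^+ 2)); first by ring.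
rewrite H; apply/eqP; rewrite subr_eq0; apply/eqP.
transitivity (p * p - q * q - fpsC h * fpsX K * (2 * (p * q) + (c * 2) * (p * p + q * q))).
  by rewrite pq; ring.
by rewrite c2; ring.
Qed.

(** sinh(c h z) / sinh(h z) as a finite geometric sum, which also covers
    h = 0, where the value is c. *)
Definition sinh_quot (c : nat) (h : K) : fps K :=
  \sum_(l < c) fexp ((c%:R - 1 - 2 * l%:R) * h).

Lemma sinh_quot_mul c h : sinh_quot c h * (fexp h - fexp (- h)) = fexp (c%:R * h) - fexp (- (c%:R * h)).
Proof.
transitivity (\sum_(0 <= l < c) (- fexp ((c%:R - 2 * l.+1%:R) * h) - - fexp ((c%:R - 2 * l%:R) * h))).
  rewrite big_mkord mulr_suml; apply: eq_bigr => l _.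
  rewrite mulrBr -!fexpD // opprK addrC; congr (- fexp _ + fexp _); rewrite -?natr1; ring.
rewrite telescope_sumr // opprK addrC; congr (fexp _ - fexp _); ring.
Qed.

(** Differentiate [sinh_quot_mul], insert [euler_log_sinh_half] for h and for
    c h, and cancel sinh(h z), which is regular unless h = 0. *)
Lemma euler_sinh_quot c h :
  euler (sinh_quot c h) = (euler_log_sinh (2 * h) - euler_log_sinh (2 * (c%:R * h))) * sinh_quot c h.
Proof.
have [->|h0] := eqVneq h 0.
  have -> : sinh_quot c 0 = c%:R.
    rewrite /sinh_quot; under eq_bigr do rewrite mulr0 fexp0.
    by rewrite sumr_const card_ord.
  rewrite !mulr0 subrr mul0r.
  by apply: fpsP => -[|n] /=; rewrite ?mul0r // fcoefMn fcoef1 /= mul0rn mulr0.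
apply/eqP; rewrite -subr_eq0; apply/eqP; apply: (@fexp_sub_regular h) => //.
have T := sinh_quot_mul c h; have dT := congr1 (@euler K) T.
rewrite eulerM !eulerD !eulerN !euler_fexp // in dT.
have L1 := euler_log_sinh_half h; have L2 := euler_log_sinh_half (c%:R * h).
have CN a : fpsC (- a) = - fpsC a :> fps K.
  by apply: fpsP => n /=; rewrite mulNrn.
rewrite !CN in dT; set f := sinh_quot c h in T dT *.
set p := fexp h in T dT L1 *; set q := fexp (- h) in T dT L1 *.
set P := fexp _ in T dT L2 *; set Q := fexp _ in T dT L2 *.
set X := fpsX K in dT L1 L2 *; set C := fpsC (c%:R * h) in dT L2 *; set H := fpsC h in dT L1 *.
have e : euler f * (p - q) = C * X * (P + Q) - f * (H * X * (p + q)).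
  transitivity (C * X * P - - C * X * Q - f * (H * X * p - - H * X * q)).
    by rewrite -dT; ring.
  by ring.
transitivity (euler f * (p - q) - f * ((p - q) * euler_log_sinh (2 * h))
    + (f * (p - q)) * euler_log_sinh (2 * (c%:R * h))); first by ring.
by rewrite e L1 T L2 mulrBr T; ring.
Qed.

Lemma fcoef_sinh_quot0 c h : (sinh_quot c h) _[0] = c%:R.
Proof.
rewrite fcoef_sum; under eq_bigr do rewrite fcoef_fexp0.
by rewrite sumr_const card_ord.
Qed.

(** The logarithmic derivatives of the factors add up to the derivative of F,
    so both sides solve the equation of exp F with the same constant term. *)
Lemma prod_sinh_quot_exp N (c : 'I_N -> nat) (h : 'I_N -> K) (F : nat -> K) :
  F =1 even_fps (fun n => zv n / (n.*2)`!%:R *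
         \sum_(j < N) (1 - (c j)%:R ^+ n.*2) * (2 * h j) ^+ n.*2) ->
  \prod_(j < N) sinh_quot (c j) (h j) = fpsC (\prod_(j < N) (c j)%:R) * Fps (fps_exp F).
Proof.
move=> FE; have F0 : F 0 = 0 by rewrite FE.
have eF : euler (Fps F) = \sum_(j < N) (euler_log_sinh (2 * h j) - euler_log_sinh (2 * ((c j)%:R * h j))).
  apply: fpsP => m; rewrite -[LHS]/(m%:R * F m) FE fcoef_sum /= /even_fps.
  have [|] := boolP (odd m || (m == 0)%N).
    by move=> _; rewrite mulr0 big1 // => j _; rewrite subr0.
  rewrite negb_or => /andP[om m0]; rewrite mulrA mulr_sumr; apply: eq_bigr => j _.
  have := odd_double_half m; rewrite (negbTE om) add0n; case: m./2 m0 => [|n].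
    by move=> + m1; rewrite -m1.
  move=> _ <-; rewrite doubleS /= factS natrM.
  have fN k : k`!%:R != 0 :> K by case: k`! (fact_gt0 k) => // k' _.
  have := char0 n.*2.+1; move: (n.*2.+2)%:R => N' N0.
  by rewrite !exprMn; field; rewrite N0 fN.
apply: (@euler_uniq _ char0 (euler (Fps F))).
- by rewrite eF; apply: euler_prod => j; apply: euler_sinh_quot.
- rewrite eulerM euler_fps_exp //.
  have -> : euler (fpsC (\prod_(j < N) (c j)%:R)) = 0 :> fps K.
    by apply: fpsP => -[|n] /=; rewrite ?mul0r ?mulr0.
  by rewrite mul0r add0r mulrCA.
- by rewrite /= mul0r.
- rewrite fcoefCM [X in _ * X]fps_exp0 mulr1.
  transitivity (\prod_(j < N) (sinh_quot (c j) (h j)) _[0]).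
    by elim/big_rec2: _ => // j x y _ <-; rewrite fcoefM0.
  by apply: eq_bigr => j _; rewrite fcoef_sinh_quot0.
Qed.

End ThetaBlock.

(** * The Laurent polynomial identities *)

(** The square of the sum is the diagonal plus twice the sum over pairs. *)
Lemma sum_pairs (R : comNzRingType) N (u : 'I_N -> R) :
  2 * (\sum_(i < N) \sum_(j < N | (i < j)%N) u i * u j) =
  (\sum_(i < N) u i) ^+ 2 - \sum_(i < N) u i ^+ 2.
Proof.
have sw : \sum_(i < N) \sum_(j < N | (j < i)%N) u i * u j =
    \sum_(i < N) \sum_(j < N | (i < j)%N) u i * u j.
  rewrite (exchange_big_dep xpredT) //=; apply: eq_bigr => i _.
  by apply: eq_bigr => j _; rewrite mulrC.
apply/eqP; rewrite eq_sym subr_eq mulr_natl mulr2n -[X in _ == X + _ + _]sw.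
rewrite -!big_split expr2 mulr_suml; apply/eqP/eq_bigr => i _ /=.
rewrite mulr_sumr (bigID (fun j : 'I_N => (j < i)%N)) /= -addrA; congr (_ + _).
rewrite (bigD1 i) ?ltnn //= expr2 addrC; congr (_ + _).
by apply: eq_bigl => j; rewrite -leqNgt (ltn_neqAle i j) eq_sym andbC.
Qed.

(** Here z_j and z'_j stand for exp(w_j z/2) and its inverse, so that the
    inner sums are the quotients sinh(c_j w_j z/2) / sinh(w_j z/2) and
    z_j^2 + z'_j^2 is u_j = 2 cosh(w_j z). Doubling the identity turns the sum
    of the u_i u_j over pairs into a square minus a sum of squares. *)
Definition theta_identity (R : comNzRingType) (z z' : nat -> R) :=
  2 * \prod_(0 <= j < 24) \sum_(0 <= l < nth 0%N c0 j)
        z j ^+ ((nth 0%N c0 j).-1 - l) * z' j ^+ l =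
  48 + (\sum_(0 <= j < 24) (z j ^+ 2 + z' j ^+ 2)) ^+ 2
  - \sum_(0 <= j < 24) (z j ^+ 2 + z' j ^+ 2) ^+ 2
  - 2 * \sum_(0 <= j < 24) (z j ^+ 2 + z' j ^+ 2).

(** Multiplicative form of the first family: x and X are mutually inverse
    and stand for exp(i alpha z/2) and exp(- i alpha z/2), and y, Y likewise for
    beta. *)
Definition half_exp1 (R : comNzRingType) (x X y Y : R) : seq R :=
  [:: y; y ^+ 2; y * x; y * X; y ^+ 2 * x; x ^+ 2; x; y ^+ 4; y ^+ 3 * x ^+ 2;
      y ^+ 3 * x; y ^+ 3; y ^+ 3 * X; y ^+ 2 * x ^+ 2;
      y ^+ 2; y ^+ 2 * X; y ^+ 2 * X ^+ 2; y * x ^+ 2; y * x; y; y * X;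
      y * X ^+ 2; x; 1; 1].

(** The same for the second family. *)
Definition half_exp2 (R : comNzRingType) (x X y Y : R) : seq R :=
  [:: y; x * y; x; x * Y; x * y ^+ 2; x * Y ^+ 2; y ^+ 2; x ^+ 2;
      x ^+ 2 * y ^+ 2; x ^+ 2 * y; x ^+ 2 * Y; x ^+ 2 * Y ^+ 2; x * y ^+ 3;
      x * y; x; y ^+ 4; x * Y; y ^+ 3; y ^+ 2; x * Y ^+ 3; y; y; 1; 1].

Lemma half_exp1_identity (R : comNzRingType) (x X y Y : R) :
  x * X = 1 -> y * Y = 1 ->
  theta_identity (nth 0 (half_exp1 x X y Y)) (nth 0 (half_exp1 X x Y y)).
Proof. by move=> hx hy; rewrite /theta_identity unlock /=; ring: hx hy. Qed.

Lemma half_exp2_identity (R : comNzRingType) (x X y Y : R) :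
  x * X = 1 -> y * Y = 1 ->
  theta_identity (nth 0 (half_exp2 x X y Y)) (nth 0 (half_exp2 X x Y y)).
Proof. by move=> hx hy; rewrite /theta_identity unlock /=; ring: hx hy. Qed.

Section Transfer.
Variable K : fieldType.
Hypothesis char0 : forall n, n.+1%:R != 0 :> K.
Variable imag : K.
Hypothesis imag2 : imag ^+ 2 = -1.
Variable zv : nat -> K.
Hypothesis zv_rec : forall n, (0 < n)%N ->
  \sum_(k < n) zv k.+1 / ((k.*2.+1)`!%:R * ((n - k).*2.-1)`!%:R) =
  (n.*2.+1)`!%:R^-1 - (2 * (n.*2)`!%:R)^-1.

Definition cosh2 (w : K) : fps K := fexp w + fexp (- w).

Lemma fcoef_cosh2 w n : (cosh2 (imag * w)) _[n] - 2 *+ (n == 0)%N =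
  2 * even_fps (fun n => (-1) ^+ n / (n.*2)`!%:R * w ^+ n.*2) n.
Proof.
rewrite /even_fps fcoefD /= [(- _) ^+ n]exprNn -[(-1) ^+ n]signr_odd.
case: n => [|n]; first by rewrite /= !expr0 fact0 invr1; ring.
have [on|en] := boolP (odd n.+1); first by rewrite /= expr1; ring.
rewrite orbF expr0 -[n.+1 == 0%N]/false mulr0n subr0.
move: (n.+1./2) (even_halfK en) => k <-.
rewrite -[in LHS]mul2n !exprM [(imag * w) ^+ 2]exprMn imag2 exprMn -exprM mul2n; ring.
Qed.

Lemma cosh2M a b : cosh2 (imag * (a + b)) + cosh2 (imag * (a - b)) =
  cosh2 (imag * a) * cosh2 (imag * b).
Proof.
rewrite /cosh2 mulrDr mulrDr !opprD mulrN opprK !fexpD //; ring.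
Qed.

Lemma fexp_X a n : fexp a ^+ n = fexp (n%:R * a) :> fps K.
Proof.
elim: n => [|n IH]; first by rewrite mul0r fexp0.
by rewrite exprS IH -fexpD // mulrS mulrDl mul1r.
Qed.

(** The identity is 2 * 1080 times the equation that defines A_c. On the right
    hand side each of the 552 terms cosh - 1 of the double sum contributes -4 to
    the constant term and each of the 24 others contributes 4, whence
    48 = 2160 - 4 * 552 + 4 * 24. *)
Lemma theta_exp (d : 'I_24 -> K) (z z' : nat -> fps K) :
  (forall j : 'I_24, z j = fexp (imag * d j / 2)) ->
  (forall j : 'I_24, z' j = fexp (- (imag * d j / 2))) ->
  theta_identity z z' ->
  fps_exp (even_fps (fun n => (-1) ^+ n / (n.*2)`!%:R * zv n *
             \sum_(j < 24) (1 - (tnth c0 j)%:R ^+ n.*2) * d j ^+ n.*2)) =1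
  (fun m => (m == 0%N)%:R + 540%:R^-1 * even_fps (fun n =>
             (-1) ^+ n / (n.*2)`!%:R *
             (\sum_(i < 24) \sum_(j < 24 | (i < j)%N)
                ((d i + d j) ^+ n.*2 + (d i - d j) ^+ n.*2)
              - \sum_(j < 24) d j ^+ n.*2)) m).
Proof.
rewrite /theta_identity !big_mkord => zE z'fexp id.
set F := even_fps _; set r := (fun m => _).
have n2 : 2 != 0 :> K := char0 1.
pose h j := imag * d j / 2.
have h2 j : 2 * h j = imag * d j by rewrite /h; field.
set u := fun j => cosh2 (imag * d j).
have uE (j : 'I_24) : z j ^+ 2 + z' j ^+ 2 = u j.
  by rewrite zE z'fexp !fexp_X mulrN h2.
move: id; under [\sum_(i < 24) (_ + _)]eq_bigr do rewrite uE.
under [\sum_(i < 24) (_ + _) ^+ 2]eq_bigr do rewrite uE.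
under [\prod_(i < 24) _]eq_bigr => j _.
  rewrite big_mkord.
  have -> : \sum_(i < nth 0%N c0 j) z j ^+ ((nth 0%N c0 j).-1 - i) * z' j ^+ i =
      sinh_quot (tnth c0 j) (h j).
    rewrite -tnth_nth; apply: eq_bigr => l _; rewrite zE z'fexp !fexp_X -fexpD //; congr fexp.
    have -> : (tnth c0 j)%:R = ((tnth c0 j).-1 - l)%:R + l%:R + 1 :> K.
      by have := ltn_ord l; rewrite -natrD natr1 => ?; congr _%:R; lia.
    by rewrite /h; ring.
  over.
rewrite (@prod_sinh_quot_exp K char0 zv zv_rec _ _ _ F) => [id|m]; last first.
  rewrite /F /even_fps; case: ifP => // _.
  rewrite !mulr_sumr; apply: eq_bigr => j _.
  rewrite h2 [(imag * d j) ^+ _]exprMn -[X in imag ^+ X]mul2n [imag ^+ _]exprM imag2.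
  by ring.
have c0E : \prod_(j < 24) (tnth c0 j)%:R = 1080%:R :> K.
  under eq_bigr do rewrite (tnth_nth 0%N).
  by rewrite -(big_mkord xpredT (fun j => (nth 0%N c0 j)%:R)) unlock /=; ring.
rewrite c0E in id.
have n1080 : 1080%:R != 0 :> K := char0 1079.
have n540 : 540%:R != 0 :> K := char0 539.
suff e : Fps (fps_exp F) = Fps r by move=> m; case: e => ->.
apply: fpsP => m; apply: (mulfI n1080); apply: (mulfI n2).
have := congr1 (fun f => f _[m]) id.
have c2 (f : fps K) n : (2 * f) _[n] = 2 * f _[n] by rewrite mulr_natl fcoefMn mulr_natl.
rewrite c2 fcoefCM => ->.
clear id.
have S : \sum_(i < 24) \sum_(j < 24 | (i < j)%N) u i * u j =
   \sum_(i < 24) \sum_(j < 24 | (i < j)%N)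
     (cosh2 (imag * (d i + d j)) + cosh2 (imag * (d i - d j))).
  by apply: eq_bigr => i _; apply: eq_bigr => j _; rewrite cosh2M.
have := sum_pairs u; rewrite S => P.
have cnt : 2 * (\sum_(i < 24) \sum_(j < 24 | (i < j)%N) 1) = 552 :> K.
  have := @sum_pairs K 24 (fun=> 1).
  under eq_bigr do under eq_bigr do rewrite mulr1.
  move=> ->; under [X in _ - X]eq_bigr do rewrite expr1n.
  by rewrite sumr_const card_ord; ring.
transitivity ((48 + (2 * (\sum_(i < 24) \sum_(j < 24 | (i < j)%N)
     (cosh2 (imag * (d i + d j)) + cosh2 (imag * (d i - d j))))) - 2 * \sum_(j < 24) u j) _[m]).
  by rewrite P; congr (_ _[_]); ring.
clear S P; rewrite fcoefD fcoefN fcoefD !c2.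
have e48 : (48 : fps K) _[m] = 48 * (m == 0)%:R.
  by rewrite fcoefMn fcoef1 mulr_natl.
have CE w := canRL (subrK _) (fcoef_cosh2 w m).
rewrite !fcoef_sum.
under eq_bigr do rewrite fcoef_sum.
under eq_bigr do under eq_bigr do rewrite fcoefD !CE.
under [\sum_(j < 24) (u j) _[_]]eq_bigr do rewrite CE.
pose e (w : K) := even_fps (fun n => (-1) ^+ n / (n.*2)`!%:R * w ^+ n.*2) m.
pose A := \sum_(i < 24) \sum_(j < 24 | (i < j)%N) (e (d i + d j) + e (d i - d j)).
pose B := \sum_(j < 24) e (d j).
have rE : r m = (m == 0)%:R + 540%:R^-1 * (A - B).
  rewrite /r /A /B /e /even_fps; congr (_ + _ * _).
  case: ifP => _.
    by rewrite !big1 ?subr0 // => i _; rewrite big1 // => j _; rewrite addr0.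
  rewrite mulrBr !mulr_sumr; congr (_ - _); apply: eq_bigr => i _.
  by rewrite mulr_sumr; apply: eq_bigr => j _; rewrite mulrDr.
transitivity (48 * (m == 0)%:R + 2 * (2 * A + 2 * (m == 0)%:R *
    (2 * \sum_(i < 24) \sum_(j < 24 | (i < j)%N) 1)) - 2 * (2 * B + 48 * (m == 0)%:R)).
  rewrite e48; congr (_ + 2 * _ - 2 * _).
    rewrite !mulr_sumr -big_split; apply: eq_bigr => i _ /=.
    rewrite !mulr_sumr -big_split; apply: eq_bigr => j _ /=.
    by rewrite /e -[2 *+ (m == _)]mulr_natr; ring.
  rewrite mulr_sumr big_split /= sumr_const card_ord; congr (_ + _).
  by rewrite -[2 *+ (m == _)]mulr_natr -mulr_natr; ring.
rewrite cnt; transitivity (2 * (1080%:R * ((m == 0)%:R + 540%:R^-1 * (A - B)))).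
  by field.
by rewrite -rE.
Qed.
End Transfer.

(** * The two families *)

Section Families.
Variable R : realType.
Local Notation C := R[i].
Implicit Types a b : C.

Lemma complex_natr_neq0 n : n.+1%:R != 0 :> C.
Proof. by rewrite pnatr_eq0. Qed.

Lemma half_exp1E (a b : C) (j : 'I_24) :
  nth 0 (half_exp1 (fexp ('i * a / 2)) (fexp (- ('i * a / 2))) (fexp ('i * b / 2)) (fexp (- ('i * b / 2)))) j
  = fexp ('i * F1 a b 0 j / 2).
Proof.
case: j => j jlt; rewrite mxE /=; have char0 := complex_natr_neq0.
do 24 (case: j jlt => [_|j jlt];
  [by rewrite /= ?(fexp_X char0) -?(fexpD char0) -?(fexp0 C); congr fexp; field |]).
by [].
Qed.

Lemma half_exp2E (a b : C) (j : 'I_24) :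
  nth 0 (half_exp2 (fexp ('i * a / 2)) (fexp (- ('i * a / 2))) (fexp ('i * b / 2)) (fexp (- ('i * b / 2)))) j
  = fexp ('i * F2 a b 0 j / 2).
Proof.
case: j => j jlt; rewrite mxE /=; have char0 := complex_natr_neq0.
do 24 (case: j jlt => [_|j jlt];
  [by rewrite /= ?(fexp_X char0) -?(fexpD char0) -?(fexp0 C); congr fexp; field |]).
by [].
Qed.

Lemma F1N a b j : F1 (- a) (- b) 0 j = - F1 a b 0 j.
Proof.
case: j => j jlt; rewrite !mxE /=.
by do 24 (case: j jlt => [_|j jlt]; [by rewrite /=; ring |]).
Qed.

Lemma F2N a b j : F2 (- a) (- b) 0 j = - F2 a b 0 j.
Proof.
case: j => j jlt; rewrite !mxE /=.
by do 24 (case: j jlt => [_|j jlt]; [by rewrite /=; ring |]).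
Qed.

Variable zeta : C -> C.
Hypothesis zeta_rec : forall n, (0 < n)%N ->
  \sum_(k < n) zeta (1 - (k.+1.*2)%:R) / ((k.*2.+1)`!%:R * ((n - k).*2.-1)`!%:R) =
  (n.*2.+1)`!%:R^-1 - (2 * (n.*2)`!%:R)^-1.

Lemma F1_mem a b : A_ zeta c0 (F1 a b).
Proof.
rewrite /A_ /=.
apply: (@theta_exp C complex_natr_neq0 'i (sqr_i R) (fun n => zeta (1 - n.*2%:R)) zeta_rec (F1 a b 0)
  _ _ (half_exp1E a b)); last first.
  by apply: half_exp1_identity; rewrite fexpN //; exact: complex_natr_neq0.
by move=> j; have := half_exp1E (- a) (- b) j; rewrite F1N !mulrN !mulNr !opprK.
Qed.

Lemma F2_mem a b : A_ zeta c0 (F2 a b).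
Proof.
rewrite /A_ /=.
apply: (@theta_exp C complex_natr_neq0 'i (sqr_i R) (fun n => zeta (1 - n.*2%:R)) zeta_rec (F2 a b 0)
  _ _ (half_exp2E a b)); last first.
  by apply: half_exp2_identity; rewrite fexpN //; exact: complex_natr_neq0.
by move=> j; have := half_exp2E (- a) (- b) j; rewrite F2N !mulrN !mulNr !opprK.
Qed.

End Families.

Section Lines.
Variable R : realType.
Local Notation C := R[i].
Local Notation V := 'rV[C]_24.

(** A linear injective parametrisation has a plane as its image. *)
Lemma proj_line_family (F : C -> C -> V) :
  (forall a b, F a b = a *: F 1 0 + b *: F 0 1) ->
  (forall a b, F a b = 0 -> a = 0 /\ b = 0) -> is_proj_line (proj_family F).
Proof.
move=> lin inj.
have mem v : v \in (<[F 1%R 0%R]> + <[F 0%R 1%R]>)%VS <-> exists p : C * C, F p.1 p.2 = v.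
  split.
    move=> /memv_addP[u /vlineP[a ->] [w /vlineP[b ->] ->]].
    by exists (a, b); rewrite lin.
  move=> [[a b] <-] /=; rewrite lin.
  by apply: memv_add; apply: memvZ; apply: memv_line.
exists (<[F 1%R 0%R]> + <[F 0%R 1%R]>)%VS.
  have n0 : F 1 0 != 0 by apply/eqP => /inj[/eqP]; rewrite oner_eq0.
  have n1 : F 0 1 != 0 by apply/eqP => /inj[_ /eqP]; rewrite oner_eq0.
  rewrite dimv_disjoint_sum ?dim_vline ?n0 ?n1 //.
  apply/eqP; rewrite -subv0; apply/subvP => v; rewrite memv_cap memv0.
  move=> /andP[/vlineP[a va] /vlineP[b vb]].
  have /inj[a0 _] : F a (- b) = 0 by rewrite lin scaleNr -va -vb subrr.
  by rewrite va a0 scale0r.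
rewrite /proj_family; congr proj_set.
apply/seteqP; split => v /=.
  by move=> [p _ Fp]; apply/mem; exists p.
by move=> /mem[p Fp]; exists p.
Qed.

Lemma proj_line_F1 : is_proj_line (proj_family (@F1 R)).
Proof.
apply: proj_line_family => a b.
  apply/rowP => -[j jlt]; rewrite !mxE /=.
  by do 24 (case: j jlt => [_|j jlt]; [by rewrite /=; ring |]).
move=> /rowP F0; split.
  by have := F0 (inord 6); rewrite !mxE inordK.
by have := F0 (inord 0); rewrite !mxE inordK.
Qed.

Lemma proj_line_F2 : is_proj_line (proj_family (@F2 R)).
Proof.
apply: proj_line_family => a b.
  apply/rowP => -[j jlt]; rewrite !mxE /=.
  by do 24 (case: j jlt => [_|j jlt]; [by rewrite /=; ring |]).
move=> /rowP F0; split.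
  by have := F0 (inord 2); rewrite !mxE inordK.
by have := F0 (inord 0); rewrite !mxE inordK.
Qed.

Lemma proj_family_sub (F : C -> C -> V) (A : set V) :
  (forall a b, A (F a b)) -> proj_family F `<=` proj_set A.
Proof.
move=> FA; apply: image_subset => v [] [p _ <-] v0.
by split => //; apply: FA.
Qed.

End Lines.

(** * Sequences and series of complex numbers *)

Section ComplexSequences.
Variable R : realType.
Local Notation C := R[i].
Implicit Types (x y e : R) (z w l : C).

(** The library norm on complex numbers takes complex values; estimates are
    more convenient with a real-valued modulus. *)
Definition cabs z : R := Normc.normc z.

Lemma cabs0 : cabs 0 = 0. Proof. exact: Normc.normc0. Qed.
Lemma cabsM z w : cabs (z * w) = cabs z * cabs w. Proof. exact: Normc.normcM. Qed.
Lemma cabsD z w : cabs (z + w) <= cabs z + cabs w. Proof. exact: le_normcD. Qed.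
Lemma cabsN z : cabs (- z) = cabs z. Proof. exact: normcN. Qed.
Lemma cabs_ge0 z : 0 <= cabs z. Proof. by case: z => a b; exact: sqrtr_ge0. Qed.
Lemma cabs_eq0 z : cabs z = 0 -> z = 0. Proof. exact: Normc.eq0_normc. Qed.
Lemma cabs_gt0 z : z != 0 -> 0 < cabs z.
Proof. by move=> z0; rewrite lt_def cabs_ge0 andbT; apply: contraNneq z0 => /cabs_eq0 ->. Qed.
Lemma cabsR x : cabs x%:C = `|x|.
Proof. by rewrite /cabs /= expr0n addr0 sqrtr_sqr. Qed.
Lemma cabs1 : cabs 1 = 1. Proof. exact: Normc.normc1. Qed.
Lemma cabsX z n : cabs (z ^+ n) = cabs z ^+ n.
Proof. by elim: n => [|n IH]; rewrite ?expr0 ?cabs1 // !exprS cabsM IH. Qed.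
Lemma cabsBC z w : cabs (z - w) = cabs (w - z). Proof. by rewrite -cabsN opprB. Qed.
Lemma cabsV z : cabs z^-1 = (cabs z)^-1. Proof. exact: Normc.normcV. Qed.
Lemma cabs_sum (I : Type) (r : seq I) (P : pred I) (F : I -> C) :
  cabs (\sum_(i <- r | P i) F i) <= \sum_(i <- r | P i) cabs (F i).
Proof.
elim/big_rec2: _ => [|i y z _ IH]; first by rewrite cabs0.
by rewrite (le_trans (cabsD _ _)) // lerD.
Qed.
Lemma Re_le_cabs z : `|complex.Re z| <= cabs z.
Proof. by case: z => a b /=; rewrite -sqrtr_sqr ler_sqrt ?addr_ge0 ?sqr_ge0 // lerDl sqr_ge0. Qed.
Lemma Im_le_cabs z : `|complex.Im z| <= cabs z.
Proof. by case: z => a b /=; rewrite -sqrtr_sqr ler_sqrt ?addr_ge0 ?sqr_ge0 // lerDr sqr_ge0. Qed.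
Lemma cabs_le_ReIm z : cabs z <= `|complex.Re z| + `|complex.Im z|.
Proof.
have n'i : cabs 'i = 1 by rewrite /cabs /= expr0n expr1n add0r sqrtr1.
rewrite {1}[z]complexE (le_trans (cabsD _ _)) //.
by rewrite cabsM !cabsR n'i mul1r.
Qed.

(** Convergence to l in the norm topology, spelled out with a real epsilon. *)
Definition ccvg (u : nat -> C) l := forall e, 0 < e ->
  exists N, forall n, (N <= n)%N -> cabs (u n - l) < e.

Lemma ccvg_of_cvg (u : nat -> C) l :
  (u : nat -> R[i]^o) @ \oo --> (l : R[i]^o) -> ccvg u l.
Proof.
move=> /cvgrPdist_lt ul e e0.
have [|N _ NP] := ul e%:C; first by rewrite ltcR.
exists N => n Nn; have := NP n Nn; rewrite /= distrC normc_def ltcR => H.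
by rewrite /cabs; move: H; case: (u n - l).
Qed.

Lemma ccvg_ext u v l : u =1 v -> ccvg u l -> ccvg v l.
Proof. by move=> uv cu e /cu[N NP]; exists N => n /NP; rewrite uv. Qed.

Lemma ccvg_cst l : ccvg (fun=> l) l.
Proof. by move=> e e0; exists 0%N => n _; rewrite subrr cabs0. Qed.

Lemma ccvg_le u l z b N : ccvg u l -> (forall n, (N <= n)%N -> cabs (u n - z) <= b) ->
  cabs (l - z) <= b.
Proof.
move=> cu ub; apply/ler_addgt0Pr => e /cu[M MP].
have := MP _ (leq_maxr N M); have := ub _ (leq_maxl N M).
set v := u _ => h1 h2; have -> : l - z = (v - z) + - (v - l) by ring.
by rewrite (le_trans (cabsD _ _)) // cabsN lerD // ltW.
Qed.

Lemma ccvg_unique u l z : ccvg u l -> ccvg u z -> l = z.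
Proof.
move=> cl cz; apply/eqP; rewrite -subr_eq0; apply/eqP/cabs_eq0/eqP.
rewrite eq_le cabs_ge0 andbT; apply/ler_addgt0Pr => e /cz[N NP]; rewrite add0r.
by apply: (@ccvg_le u l z e N) => // n /NP/ltW.
Qed.

Lemma ccvgD u v l z : ccvg u l -> ccvg v z -> ccvg (fun n => u n + v n) (l + z).
Proof.
move=> cu cv e e0; have e2 : 0 < e / 2 by lra.
have [N NP] := cu _ e2; have [M MP] := cv _ e2.
exists (maxn N M) => n; rewrite geq_max => /andP[/NP h1 /MP h2].
have -> : u n + v n - (l + z) = (u n - l) + (v n - z) by ring.
by have := cabsD (u n - l) (v n - z); lra.
Qed.

Lemma ccvgZ u l c : ccvg u l -> ccvg (fun n => c * u n) (c * l).
Proof.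
move=> cu e e0; have c0 : 0 < cabs c + 1 by have := cabs_ge0 c; lra.
have [N NP] := cu _ (divr_gt0 e0 c0); exists N => n /NP h.
rewrite -mulrBr cabsM; rewrite ltr_pdivlMr // in h.
have := cabs_ge0 (u n - l); nra.
Qed.

Lemma ccvg_shift u l k : ccvg (fun n => u (n + k)%N) l <-> ccvg u l.
Proof.
split=> cu e /cu[N NP].
  exists (N + k)%N => n Nn; have := NP (n - k)%N; rewrite subnK; last lia.
  by apply; lia.
by exists N => n Nn; apply: NP; lia.
Qed.

Lemma ccvg_sum (I : Type) (r : seq I) (u : I -> nat -> C) (l : I -> C) :
  (forall i, ccvg (u i) (l i)) ->
  ccvg (fun n => \sum_(i <- r) u i n) (\sum_(i <- r) l i).
Proof.
move=> ul; elim: r => [|i r IH].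
  by rewrite big_nil; apply: ccvg_ext (ccvg_cst 0) => n; rewrite big_nil.
by rewrite big_cons; apply: ccvg_ext (ccvgD (ul i) IH) => n; rewrite big_cons.
Qed.

Lemma ccvg_sumord N (u : 'I_N -> nat -> C) (l : 'I_N -> C) :
  (forall i, ccvg (u i) (l i)) ->
  ccvg (fun n => \sum_(i < N) u i n) (\sum_(i < N) l i).
Proof. exact: ccvg_sum. Qed.

Lemma bounded_series (B : nat -> R) M : (forall n, 0 <= B n) ->
  (forall N, \sum_(n < N) B n <= M) ->
  exists S, [/\ S <= M, forall N, \sum_(n < N) B n <= S &
    forall e, 0 < e -> exists N, forall n, (N <= n)%N -> S - \sum_(i < n) B i < e].
Proof.
move=> B0 BM; pose A := range (fun N => \sum_(n < N) B n).
have hA : has_sup A by split; [exists (\sum_(n < 0) B n); exists 0%N | exists M => _ [N _ <-]].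
exists (sup A); split.
- by apply: ge_sup; [case: hA | move=> _ [N _ <-]].
- by move=> N; apply: ub_le_sup; [case: hA | exists N].
- move=> e e0; have [_ [N _ <-] hN] := sup_adherent e0 hA.
  exists N => n Nn; suff : \sum_(i < N) B i <= \sum_(i < n) B i by lra.
  rewrite (big_ord_widen n B Nn) [leRHS](bigID (fun i : 'I_n => (i < N)%N)) /= lerDl.
  by apply: sumr_ge0.
Qed.

Lemma sum_split (V : zmodType) (u : nat -> V) N n : (N <= n)%N ->
  \sum_(i < n) u i = \sum_(i < N) u i + \sum_(N <= i < n) u i.
Proof. by move=> Nn; rewrite -!(big_mkord xpredT u) (big_cat_nat (n := N)). Qed.

Lemma abs_tail (u : nat -> C) (B : nat -> R) N n : (N <= n)%N ->
  (forall i, cabs (u i) <= B i) ->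
  cabs (\sum_(i < n) u i - \sum_(i < N) u i) <= \sum_(i < n) B i - \sum_(i < N) B i.
Proof.
move=> Nn uB; rewrite (sum_split u Nn) (sum_split B Nn) ![_ + _ - _]addrAC !subrr !add0r.
by rewrite (le_trans (cabs_sum _ _ _)) // ler_sum.
Qed.

(** For a real series dominated by B, the series of B + v has nonnegative
    terms and is bounded, hence converges; subtract that of B. *)
Lemma abs_ccvg (u : nat -> C) (B : nat -> R) M :
  (forall n, cabs (u n) <= B n) -> (forall N, \sum_(n < N) B n <= M) ->
  exists l, ccvg (fun N => \sum_(n < N) u n) l.
Proof.
move=> uB BM; have B0 n : 0 <= B n := le_trans (cabs_ge0 _) (uB n).
have [S [_ Sge SB]] := bounded_series B0 BM.
(* applied to the real and to the imaginary parts *)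
have real_part (v : nat -> R) : (forall n, `|v n| <= B n) -> exists s, forall e, 0 < e ->
    exists N, forall n, (N <= n)%N -> `|\sum_(i < n) v i - s| < e.
  move=> vB.
  have [||T [_ Tge TB]] := @bounded_series (fun n => B n + v n) (M + M).
  - by move=> n; have := vB n; rewrite ler_norml; lra.
  - move=> N; rewrite big_split lerD //= (le_trans _ (BM N)) // ler_sum // => i _.
    by rewrite (le_trans (ler_norm _)).
  exists (T - S) => e e0; have e2 : 0 < e / 2 by lra.
  have [N1 h1] := SB _ e2; have [N2 h2] := TB _ e2.
  exists (maxn N1 N2) => n; rewrite geq_max => /andP[/h1 a1 /h2 a2].
  have b1 := Sge n; have := Tge n; rewrite big_split /= in a2 *.
  by rewrite ltr_norml; lra.
have [x xP] := real_part (fun n => complex.Re (u n)) (fun n => le_trans (Re_le_cabs _) (uB n)).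
have [|y yP] := real_part (fun n => complex.Im (u n)).
  by move=> n; rewrite (le_trans _ (uB n)) // Im_le_cabs.
exists (x +i* y) => e e0; have e2 : 0 < e / 2 by lra.
have [N1 h1] := xP _ e2; have [N2 h2] := yP _ e2.
exists (maxn N1 N2) => n; rewrite geq_max => /andP[/h1 a1 /h2 a2].
rewrite (le_lt_trans (cabs_le_ReIm _)) // [ltRHS]splitr.
rewrite (_ : \sum_(i < n) u i = (\sum_(i < n) complex.Re (u i)) +i* (\sum_(i < n) complex.Im (u i))).
  by rewrite /= ltrD.
clear; elim: n => [|n IH]; first by rewrite !big_ord0.
by rewrite !big_ord_recr IH /=; case: (u n).
Qed.

(** With M the supremum of the partial sums of B, the right hand side tends
    to 0 as N grows. *)
Lemma abs_tail_lim (u : nat -> C) (B : nat -> R) M l N :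
  (forall n, cabs (u n) <= B n) -> (forall N, \sum_(n < N) B n <= M) ->
  ccvg (fun N => \sum_(n < N) u n) l ->
  cabs (l - \sum_(i < N) u i) <= M - \sum_(i < N) B i.
Proof.
move=> uB BM cu; apply: (ccvg_le cu (N := N)) => n Nn.
by rewrite (le_trans (abs_tail Nn uB)) // lerB.
Qed.

End ComplexSequences.
Arguments cabs : simpl never.

(** * Power series and the identity theorem along a segment *)

Section PowerSeries.
Variable R : realType.
Local Notation C := R[i].
Implicit Types (r e M : R) (s t c : C) (a b : nat -> C) (f g : C -> C).

(** f(s0 + t) is given on the closed disc of radius r by a power series in t
    whose l1 norm on that disc is at most M. The norm makes locally uniform
    limits available without Cauchy's integral formula. *)
Definition expands r M a f s0 :=
  (forall J, \sum_(j < J) cabs (a j) * r ^+ j <= M) /\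
  (forall t, cabs t <= r -> ccvg (fun J => \sum_(j < J) a j * t ^+ j) (f (s0 + t))).

Definition ana f s0 := exists r M a, 0 < r /\ expands r M a f s0.

Lemma expandsD r M M' a b f g s0 :
  0 <= r -> expands r M a f s0 -> expands r M' b g s0 ->
  expands r (M + M') (fun j => a j + b j) (fun s => f s + g s) s0.
Proof.
move=> r0 [fM ft] [gM gt]; split=> [J|t tr].
  rewrite (le_trans _ (lerD (fM J) (gM J))) // -big_split ler_sum //= => j _.
  by rewrite -mulrDl ler_wpM2r ?exprn_ge0 // cabsD.
apply: ccvg_ext (ccvgD (ft _ tr) (gt _ tr)) => J.
by rewrite -big_split; apply: eq_bigr => j _; rewrite mulrDl.
Qed.

Lemma expandsZ r M a f s0 c : expands r M a f s0 ->
  expands r (cabs c * M) (fun j => c * a j) (fun s => c * f s) s0.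
Proof.
move=> [fM ft]; split=> [J|t tr].
  rewrite (le_trans _ (ler_wpM2l (cabs_ge0 c) (fM J))) // mulr_sumr ler_sum // => j _.
  by rewrite cabsM mulrA.
apply: ccvg_ext (ccvgZ c (ft _ tr)) => J.
by rewrite mulr_sumr; apply: eq_bigr => j _; rewrite mulrA.
Qed.

Definition shiftc a j : C := if j is j'.+1 then a j' else 0.
(** The coefficients of (c - t) times the series with coefficients a. *)
Definition mul_lin c a j := c * a j - shiftc a j.

Lemma l1_mul_lin r M c a : 0 <= r ->
  (forall J, \sum_(j < J) cabs (a j) * r ^+ j <= M) ->
  forall J, \sum_(j < J) cabs (mul_lin c a j) * r ^+ j <= (cabs c + r) * M.
Proof.
move=> r0 aM J.
apply: (@le_trans _ _ (\sum_(j < J) (cabs c * (cabs (a j) * r ^+ j) +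
    cabs (shiftc a j) * r ^+ j))).
  apply: ler_sum => j _; rewrite mulrA -mulrDl ler_wpM2r ?exprn_ge0 //.
  by rewrite (le_trans (cabsD _ _)) // cabsN cabsM.
rewrite big_split mulrDl lerD //=.
  by rewrite -mulr_sumr ler_wpM2l ?cabs_ge0 ?aM.
case: J => [|J].
  by rewrite big_ord0 mulr_ge0 //; have := aM 0%N; rewrite big_ord0.
rewrite big_ord_recl cabs0 mul0r add0r.
rewrite (le_trans _ (ler_wpM2l r0 (aM J))) // mulr_sumr ler_sum // => j _.
by rewrite /= exprS mulrCA.
Qed.

Lemma ccvg_mul_lin c a t l : ccvg (fun J => \sum_(j < J) a j * t ^+ j) l ->
  ccvg (fun J => \sum_(j < J) mul_lin c a j * t ^+ j) ((c - t) * l).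
Proof.
move=> F; apply/(ccvg_shift _ _ 1).
have -> : (c - t) * l = c * l + (- t) * l by ring.
have F1 := (iffRL (ccvg_shift _ _ 1) F).
apply: ccvg_ext (ccvgD (ccvgZ c F1) (ccvgZ (- t) F)) => J; rewrite addn1.
under [RHS]eq_bigr do rewrite mulrBl.
rewrite sumrB; congr (_ + _).
  by rewrite mulr_sumr; apply: eq_bigr => j _; rewrite mulrA.
rewrite big_ord_recl mul0r add0r mulNr mulr_sumr; congr (- _).
by apply: eq_bigr => j _; rewrite /= exprS mulrCA.
Qed.

Lemma expands_lin r M a f s0 c : 0 <= r -> expands r M a f s0 ->
  expands r ((cabs c + r) * M) (mul_lin c a) (fun s => (c - (s - s0)) * f s) s0.
Proof.
move=> r0 [fM ft]; split; first exact: l1_mul_lin.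
move=> t tr; have -> : c - (s0 + t - s0) = c - t by ring.
exact: ccvg_mul_lin (ft _ tr).
Qed.

Lemma expands_le r r' M a f s0 : 0 <= r' <= r -> expands r M a f s0 ->
  expands r' M a f s0.
Proof.
move=> /andP[r'0 rr] [fM ft]; split=> [J|t tr]; last by apply: ft; apply: le_trans rr.
rewrite (le_trans _ (fM J)) // ler_sum // => j _.
by rewrite ler_wpM2l ?cabs_ge0 // lerXn2r // nnegrE // (le_trans r'0).
Qed.

Lemma anaD f g s0 : ana f s0 -> ana g s0 -> ana (fun s => f s + g s) s0.
Proof.
move=> [r [M [a [r0 fa]]]] [r' [M' [b [r'0 gb]]]].
have m0 : 0 < Num.min r r' by rewrite lt_min r0.
exists (Num.min r r'), (M + M'), (fun j => a j + b j); split=> //.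
apply: expandsD; first exact: ltW.
  by apply: expands_le fa; rewrite ltW //= ge_min lexx.
by apply: expands_le gb; rewrite ltW //= ge_min lexx orbT.
Qed.

Lemma anaZ f s0 c : ana f s0 -> ana (fun s => c * f s) s0.
Proof.
by move=> [r [M [a [r0 fa]]]]; exists r, (cabs c * M), (fun j => c * a j); split=> //; apply: expandsZ.
Qed.

Lemma ana_ext f g s0 : f =1 g -> ana f s0 -> ana g s0.
Proof. by move=> /funext ->. Qed.

Lemma ana_lin f s0 c : ana f s0 -> ana (fun s => (c - s) * f s) s0.
Proof.
move=> [r [M [a [r0 fa]]]]; exists r, ((cabs (c - s0) + r) * M), (mul_lin (c - s0) a); split=> //.
have := expands_lin (c - s0) (ltW r0) fa.
by rewrite (_ : (fun s => (c - s0 - (s - s0)) * f s) = (fun s => (c - s) * f s)) //;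
  apply/funext => s; congr (_ * _); ring.
Qed.

Lemma ana_cst c s0 : ana (fun=> c) s0.
Proof.
exists 1, (cabs c), (fun j => c *+ (j == 0)%N); split=> //; split=> [[|J]|t _].
- by rewrite big_ord0 cabs_ge0.
- rewrite big_ord_recl big1 /= ?mulr1n ?expr0 ?mulr1 ?addr0 // => j _.
  by rewrite ?mulr0n cabs0 mul0r.
- apply/(ccvg_shift _ _ 1); apply: ccvg_ext (ccvg_cst c) => J; rewrite addn1.
  by rewrite big_ord_recl big1 /= ?expr0 ?mulr1 ?addr0 // => j _; rewrite ?mulr0n mul0r.
Qed.

Lemma ana_shift f s0 c : ana f (s0 + c) -> ana (fun s => f (s + c)) s0.
Proof.
move=> [r [M [a [r0 [aM at_]]]]]; exists r, M, a; split=> //; split=> // t tr.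
by rewrite addrAC; apply: at_.
Qed.

Lemma ana_sum (I : Type) (q : seq I) (F : I -> C -> C) s0 :
  (forall i, ana (F i) s0) -> ana (fun s => \sum_(i <- q) F i s) s0.
Proof.
move=> FA; elim: q => [|i q IH].
  by apply: ana_ext (ana_cst 0 s0) => s; rewrite big_nil.
by apply: ana_ext (anaD (FA i) IH) => s; rewrite big_cons.
Qed.

(** Convergence at one point of modulus rho bounds the terms there, and the
    series is then dominated by a geometric one on the disc of radius rho/2. *)
Lemma ana_of_analytic f s0 : analytic_at f s0 -> ana f s0.
Proof.
move=> [a /nbhs_normP[e /= e0 eP]].
have eE : e = (complex.Re e)%:C.
  by case: e e0 {eP} => x y; rewrite ltcE /= => /andP[/eqP -> _].
set r2 := complex.Re e in eE; have r20 : 0 < r2 by rewrite eE ltcR in e0.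
have conv t : cabs t < r2 -> ccvg (fun J => \sum_(j < J) a j * t ^+ j) (f (s0 + t)).
  move=> tr; have /eP/ccvg_of_cvg : (ball_ Num.norm s0 e) (s0 + t).
    rewrite /ball_ /= opprD addrA subrr sub0r normrN normc_def eE ltcR.
    by move: tr; case: (t).
  by apply: ccvg_ext => J; rewrite /series /= big_mkord; apply: eq_bigr => j _; rewrite addrC addKr.
(* the series converges at the real point rho, inside the disc *)
pose rho := r2 / 2; have rho0 : 0 < rho by rewrite /rho; lra.
have [|N NP] := conv (rho%:C) _ 1 ltr01.
  by rewrite cabsR gtr0_norm // /rho; lra.
set l := f _ in NP.
have late j : (N <= j)%N -> cabs (a j) * rho ^+ j <= 2.
  move=> Nj; have h1 := NP _ Nj; have h2 := NP _ (leqW Nj).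
  rewrite big_ord_recr /= in h2; set S := \sum_(i < j) _ in h1 h2.
  have : a j * rho%:C ^+ j = (S + a j * rho%:C ^+ j - l) + - (S - l) by ring.
  move=> /(congr1 (@cabs R)); rewrite cabsM cabsX cabsR gtr0_norm // => ->.
  by rewrite (le_trans (cabsD _ _)) // cabsN; lra.
pose M0 := 2 + \sum_(j < N) cabs (a j) * rho ^+ j.
have term_ge0 j : 0 <= cabs (a j) * rho ^+ j by rewrite mulr_ge0 ?cabs_ge0 ?exprn_ge0 // ltW.
have bd j : cabs (a j) * rho ^+ j <= M0.
  have S0 : 0 <= \sum_(j < N) cabs (a j) * rho ^+ j by apply: sumr_ge0.
  have [/late|jN] := leqP N j; first by rewrite /M0; lra.
  have : cabs (a j) * rho ^+ j <= \sum_(j < N) cabs (a j) * rho ^+ j.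
    by rewrite (bigD1 (Ordinal jN)) //= lerDl sumr_ge0.
  by rewrite /M0; lra.
exists (rho / 2), (M0 * 2), a; split; first by lra.
split=> [J|t tr]; last by apply: conv; rewrite (le_lt_trans tr) // /rho; lra.
apply: (@le_trans _ _ (\sum_(j < J) M0 * (2^-1) ^+ j)).
  by apply: ler_sum => j _; rewrite exprMn mulrA ler_wpM2r ?exprn_ge0 ?invr_ge0.
rewrite -mulr_sumr ler_wpM2l //; first exact: le_trans (bd 0%N).
have -> : \sum_(j < J) (2^-1) ^+ j = 2 - 2 * (2^-1) ^+ J :> R.
  elim: J => [|J IH]; first by rewrite big_ord0 expr0; lra.
  by rewrite big_ord_recr IH exprS /=; field.
by rewrite lerBlDr lerDl mulr_ge0 // exprn_ge0 // invr_ge0.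
Qed.

(** If a_m is the first nonzero coefficient, the series is a_m t^m up to
    O(t^(m+1)) and has no zero t other than 0 near 0. *)
Lemma ana_zero f s0 : ana f s0 ->
  (forall e, 0 < e -> exists t, 0 < cabs t < e /\ f (s0 + t) = 0) ->
  exists r, 0 < r /\ forall t, cabs t <= r -> f (s0 + t) = 0.
Proof.
move=> [r [M [a [r0 [aM conv]]]]] acc.
have a0 : forall m, a m = 0.
  elim/ltn_ind => m IH; apply/eqP; apply: contraT => /cabs_gt0 am.
  have M0 : 0 <= M by have := aM 0%N; rewrite big_ord0.
  have rm : 0 < r ^+ m.+1 by rewrite exprn_gt0.
  pose e := Num.min r (cabs (a m) * r ^+ m.+1 / (M + 1)).
  have e0 : 0 < e.
    by rewrite /e lt_min r0 /= divr_gt0 ?mulr_gt0 //; lra.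
  have [t [/andP[t0 te] ft]] := acc _ e0.
  have tr : cabs t <= r by rewrite ltW // (lt_le_trans te) // ge_min lexx.
  have := conv _ tr; rewrite ft => cv0.
  have : cabs (0 - a m * t ^+ m) <= cabs t ^+ m.+1 / r ^+ m.+1 * M.
    apply: (ccvg_le cv0 (N := m.+1)) => J mJ.
    rewrite (sum_split (fun j => a j * t ^+ j) mJ) big_ord_recr /= big1 => [|j _]; last first.
      by rewrite IH // mul0r.
    rewrite add0r addrAC subrr add0r (le_trans (cabs_sum _ _ _)) //.
    apply: (@le_trans _ _ (cabs t ^+ m.+1 / r ^+ m.+1 * \sum_(m.+1 <= j < J) cabs (a j) * r ^+ j)).
      rewrite mulr_sumr ler_sum_nat // => j /andP[mj _].
      rewrite cabsM cabsX mulrCA ler_wpM2l ?cabs_ge0 // -(subnKC mj) !exprD.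
      rewrite [_ * (r ^+ _ * _)]mulrA -[_ / _ * _]mulrA mulVf ?gt_eqF // mulr1.
      by rewrite ler_wpM2l ?exprn_ge0 ?cabs_ge0 // lerXn2r ?nnegrE ?cabs_ge0 // ltW.
    rewrite ler_wpM2l ?divr_ge0 ?exprn_ge0 ?cabs_ge0 ?(ltW r0) //.
    rewrite (le_trans _ (aM J)) // (sum_split (fun j => cabs (a j) * r ^+ j) mJ) lerDr.
    by apply: sumr_ge0 => j _; rewrite mulr_ge0 ?cabs_ge0 ?exprn_ge0 // ltW.
  rewrite sub0r cabsN cabsM cabsX exprS.
  have -> : cabs t * cabs t ^+ m / r ^+ m.+1 * M = cabs t * M / r ^+ m.+1 * cabs t ^+ m by ring.
  rewrite ler_pM2r ?exprn_gt0 // ler_pdivlMr // => h.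
  have : cabs t < cabs (a m) * r ^+ m.+1 / (M + 1) by rewrite (lt_le_trans te) // ge_min lexx orbT.
  rewrite ltr_pdivlMr; last by lra.
  by have := cabs_ge0 t; nra.
exists r; split=> // t /conv cv; apply: (ccvg_unique cv).
by apply: ccvg_ext (ccvg_cst 0) => J; rewrite big1 // => j _; rewrite a0 mul0r.
Qed.

(** Identity theorem along p + x v, 0 <= x <= 1. Let T be the supremum of
    the y such that f vanishes on [0, y]. The zeros accumulate at T, so f
    vanishes on a disc around the corresponding point, and T = 1. *)
Lemma ana_segment f (p v : C) d : v != 0 -> 0 < d -> 
  (forall x : R, 0 <= x <= 1 -> ana f (p + x%:C * v)) ->
  (forall x : R, 0 <= x < d -> f (p + x%:C * v) = 0) -> f (p + v) = 0.
Proof.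
move=> v0 d0 fA f0.
pose A := [set y : R | 0 <= y <= 1 /\ forall x, 0 <= x <= y -> f (p + x%:C * v) = 0].
have vn := cabs_gt0 v0.
pose y0 := Num.min 1 (d / 2).
have y00 : 0 < y0 by rewrite lt_min ltr01 divr_gt0.
have Ay0 : A y0.
  split; first by rewrite ltW //= ge_min lexx.
  move=> x /andP[x0 xy]; apply: f0; rewrite x0 (le_lt_trans xy) //.
  by rewrite gt_min; apply/orP; right; lra.
have hA : has_sup A by split; [exists y0 | exists 1 => y [/andP[]]].
set T := sup A.
have Ty0 : y0 <= T by apply: ub_le_sup; case: hA.
have T1 : T <= 1 by apply: ge_sup; [case: hA | move=> y [/andP[]]].
have below x : 0 <= x < T -> f (p + x%:C * v) = 0.
  move=> /andP[x0 xT]; have [|y [_ yA] hy] := @sup_adherent _ A (T - x) _ hA; first by lra.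
  by apply: yA; rewrite x0; rewrite -/T in hy; lra.
have [||r [r0 rP]] := ana_zero (fA T _).
- by rewrite T1 (le_trans _ Ty0) // ltW.
- move=> e e0; pose x := Num.min (T / 2) (e / 2 / cabs v).
  have x0 : 0 < x by rewrite lt_min !divr_gt0 //; lra.
  exists (- x%:C * v); rewrite cabsM cabsN cabsR gtr0_norm //; split.
    rewrite mulr_gt0 //= -ltr_pdivlMr // (@le_lt_trans _ _ (e / 2 / cabs v)) //.
      by rewrite ge_min lexx orbT.
    by rewrite ltr_pM2r ?invr_gt0 //; lra.
  rewrite -addrA -mulrDl -rmorphB; apply: below.
  have : x <= T / 2 by rewrite ge_min lexx.
  by lra.
pose z := Num.min 1 (T + r / cabs v).
have rv : 0 < r / cabs v by rewrite divr_gt0.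
have near x : T <= x -> x <= z -> f (p + x%:C * v) = 0.
  move=> Tx xz.
  have -> : p + x%:C * v = (p + T%:C * v) + (x - T)%:C * v by rewrite rmorphB /=; ring.
  apply: rP; rewrite cabsM cabsR ger0_norm ?subr_ge0 // -ler_pdivlMr // lerBlDl.
  by rewrite (le_trans xz) // ge_min lexx orbT.
have Az : A z.
  split; first by rewrite /z ge_min lexx /= le_min ler01 /=; lra.
  move=> x /andP[x0 xz]; have [xT|Tx] := ltP x T; first by apply: below; rewrite x0.
  exact: near.
have zT : z <= T by apply: ub_le_sup => //; case: hA.
have z1 : T = 1.
  apply/eqP; rewrite eq_le T1 leNgt; apply/negP => T1'.
  by move: zT; rewrite /z ge_min !leNgt T1' /= ltrDl rv.
have := near 1; rewrite mul1r; apply; first by rewrite T1.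
by rewrite /z le_min lexx z1 lerDl ltW.
Qed.

End PowerSeries.

(** * Taylor bounds and derivatives of complex-valued functions *)

Section Taylor.
Variable R : realType.
Implicit Types (x y M : R).

(** Mean value theorem. *)
Lemma derive_ge0_le (h h' : R -> R) x : 0 <= x ->
  (forall y, 0 <= y <= x -> is_derive y 1 h (h' y)) ->
  (forall y, 0 <= y <= x -> 0 <= h' y) -> h 0 <= h x.
Proof.
move=> x0 dh h'0.
have [||c c0 e] := @MVT_segment R h h' 0 x x0.
- by move=> y; rewrite in_itv /= => /andP[y1 y2]; apply: dh; rewrite !ltW.
- apply: derivable_within_continuous => y; rewrite in_itv /= => yx.
  by case: (dh y yx).
by rewrite -subr_ge0 e mulr_ge0 ?subr_ge0 // h'0; move: c0; rewrite in_itv.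
Qed.

(** Compare h with the primitive M x^(K+1) / (K+1)! of the bound. *)
Lemma derive_bound (h h' : R -> R) K M x : 0 <= x ->
  (forall y, 0 <= y <= x -> is_derive y 1 h (h' y)) -> h 0 = 0 ->
  (forall y, 0 <= y <= x -> `|h' y| <= M * y ^+ K / K`!%:R) ->
  `|h x| <= M * x ^+ K.+1 / K.+1`!%:R.
Proof.
move=> x0 dh h00 hb.
pose P y := M / K.+1`!%:R * y ^+ K.+1; pose P' y := M * y ^+ K / K`!%:R.
have dP y : is_derive y 1 P (P' y).
  rewrite /P; have -> : (fun y => M / K.+1`!%:R * y ^+ K.+1) = (M / K.+1`!%:R) *: (@id R ^+ K.+1).
    by apply/funext => z; rewrite /= fctE.
  apply: is_derive_eq; rewrite /P' /= /GRing.scale /= factS natrM.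
  have a0 : K.+1%:R != 0 :> R by rewrite pnatr_eq0.
  have f0 : K`!%:R != 0 :> R by rewrite pnatr_eq0 -lt0n fact_gt0.
  by move: a0 f0; move: K.+1%:R K`!%:R => a f a0 f0; field; rewrite a0 f0.
have -> : M * x ^+ K.+1 / K.+1`!%:R = P x by rewrite /P mulrAC.
have P0 : P 0 = 0 by rewrite /P expr0n mulr0.
have hP (s : R) : `|s| = 1 -> s * h x <= P x.
  move=> s1; rewrite -subr_ge0.
  have := @derive_ge0_le (fun y => P y - s * h y) (fun y => P' y - s * h' y) x x0.
  rewrite P0 h00 mulr0 subr0; apply => y yx.
    have dhy := dh y yx.
    have -> : (fun y => P y - s * h y) = P - s *: h by apply/funext.
    exact: is_derive_eq.
  have := hb y yx; rewrite subr_ge0 => hby.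
  by rewrite (le_trans (ler_norm _)) // normrM s1 mul1r.
rewrite ler_norml; have := hP 1 (normr1 _); have := hP (-1) (normrN1 _).
by lra.
Qed.

(** The difference on the left vanishes at 0 and its derivative is the same
    difference for the shifted family of derivatives. *)
Lemma taylor_bound (g : nat -> R -> R) K M :
  (forall k x, 0 <= x <= 1 -> is_derive x 1 (g k) (g k.+1 x)) ->
  (forall x, 0 <= x <= 1 -> `|g K x| <= M) ->
  forall x, 0 <= x <= 1 ->
  `|g 0%N x - \sum_(k < K) g k 0 * x ^+ k / k`!%:R| <= M * x ^+ K / K`!%:R.
Proof.
elim: K g => [|K IH] g dg gM x x01.
  by rewrite big_ord0 subr0 expr0 mulr1 fact0 divr1 gM.
have {}IH := IH (fun k => g k.+1) (fun k => dg k.+1) gM.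
have/andP[x0 x1] := x01.
apply: (@derive_bound (fun x => g 0%N x - \sum_(k < K.+1) g k 0 * x ^+ k / k`!%:R)
  (fun x => g 1%N x - \sum_(k < K) g k.+1 0 * x ^+ k / k`!%:R)) => //.
- move=> y /andP[y0 yx]; have dy : is_derive y 1 (g 0%N) (g 1%N y).
    by apply: dg; rewrite y0 (le_trans yx).
  have -> : (fun x => g 0%N x - \sum_(k < K.+1) g k 0 * x ^+ k / k`!%:R) =
      g 0%N - \sum_(k < K.+1) (g k 0 / k`!%:R) *: (@id R ^+ k).
    apply/funext => z; rewrite fctE /=; congr (_ - _).
    by rewrite fct_sumE; apply: eq_bigr => k _; rewrite fctE mulrAC.
  have dk : forall i : 'I_K.+1, is_derive y 1 ((g i 0 / i`!%:R) *: (@id R ^+ i))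
      ((g i 0 / i`!%:R) *: ((i%:R * y ^+ i.-1) *: (1 : R))).
    by move=> i; exact: is_deriveZ.
  have D := is_deriveB dy (is_derive_sum dk).
  move: D => /is_derive_eq; apply.
  congr (_ - _); rewrite big_ord_recl /= mul0r scale0r scaler0 add0r.
  apply: eq_bigr => k _; rewrite /GRing.scale /= /bump /= add1n factS natrM.
  have a0 : k.+1%:R != 0 :> R by rewrite pnatr_eq0.
  have f0 : k`!%:R != 0 :> R by rewrite pnatr_eq0 -lt0n fact_gt0.
  by move: a0 f0; move: k.+1%:R k`!%:R => a f a0 f0; field; rewrite a0 f0.
- rewrite big_ord_recl expr0 fact0 big1 /= => [|k _]; last by rewrite expr0n mulr0 mul0r.
  by rewrite mulr1 divr1 addr0 subrr.
- by move=> y /andP[y0 yx]; apply: IH; rewrite y0 (le_trans yx).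
Qed.

End Taylor.

Section ComplexDerivative.
Variable R : realType.
Local Notation C := R[i].
Implicit Types (x : R) (z l : C) (f g : R -> C).

(** The derivative of a complex-valued function of a real variable. *)
Definition cderive f x l :=
  is_derive x 1 (fun y => complex.Re (f y)) (complex.Re l) /\
  is_derive x 1 (fun y => complex.Im (f y)) (complex.Im l).

Lemma cderive_eq f x l l' : cderive f x l -> l = l' -> cderive f x l'.
Proof. by move=> h <-. Qed.

Lemma cderive_cst z x : cderive (fun=> z) x 0.
Proof. by split; apply: is_derive_cst. Qed.

Lemma cderiveD f g x l m : cderive f x l -> cderive g x m -> cderive (fun y => f y + g y) x (l + m).
Proof.
move=> [f1 f2] [g1 g2]; split.
  rewrite (_ : (fun y => _) = (fun y => complex.Re (f y)) + (fun y => complex.Re (g y))).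
    by apply: is_derive_eq; case: l m {f1 f2 g1 g2} => ? ? [].
  by apply/funext => y; rewrite fctE; case: (f y) (g y) => ? ? [].
rewrite (_ : (fun y => _) = (fun y => complex.Im (f y)) + (fun y => complex.Im (g y))).
  by apply: is_derive_eq; case: l m {f1 f2 g1 g2} => ? ? [].
by apply/funext => y; rewrite fctE; case: (f y) (g y) => ? ? [].
Qed.

Lemma cderiveM f g x l m : cderive f x l -> cderive g x m ->
  cderive (fun y => f y * g y) x (l * g x + f x * m).
Proof.
move=> [f1 f2] [g1 g2]; split.
  rewrite (_ : (fun y => _) = (fun y => complex.Re (f y)) * (fun y => complex.Re (g y)) -
     (fun y => complex.Im (f y)) * (fun y => complex.Im (g y))).
    have := is_deriveB (is_deriveM f1 g1) (is_deriveM f2 g2).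
    move=> /is_derive_eq; apply; rewrite /GRing.scale /=.
    by case: l m (f x) (g x) {f1 f2 g1 g2} => ? ? [? ?] [? ?] [? ?] /=; ring.
  by apply/funext => y; rewrite !fctE; case: (f y) (g y) => ? ? [].
rewrite (_ : (fun y => _) = (fun y => complex.Re (f y)) * (fun y => complex.Im (g y)) +
     (fun y => complex.Im (f y)) * (fun y => complex.Re (g y))).
  have := is_deriveD (is_deriveM f1 g2) (is_deriveM f2 g1).
  move=> /is_derive_eq; apply; rewrite /GRing.scale /=.
  by case: l m (f x) (g x) {f1 f2 g1 g2} => ? ? [? ?] [? ?] [? ?] /=; ring.
by apply/funext => y; rewrite !fctE; case: (f y) (g y) => ? ? [].
Qed.

Lemma cderiveZ f z x l : cderive f x l -> cderive (fun y => z * f y) x (z * l).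
Proof. by move=> fl; apply: cderive_eq (cderiveM (cderive_cst z x) fl) _; rewrite mul0r add0r. Qed.

Lemma cderive_real (h : R -> R) x d : is_derive x 1 h d -> cderive (fun y => (h y)%:C) x d%:C.
Proof. by move=> dh; split=> //=; apply: is_derive_cst. Qed.

Lemma cderive_Cexp f x l : cderive f x l -> cderive (fun y => Cexp (f y)) x (l * Cexp (f x)).
Proof.
move=> [f1 f2].
have dE := is_derive1_comp (is_derive_expR (complex.Re (f x))) f1.
have dc := is_derive1_comp (is_derive_cos (complex.Im (f x))) f2.
have ds := is_derive1_comp (is_derive_sin (complex.Im (f x))) f2.
split.
  rewrite (_ : (fun y => _) = (expR \o (fun y => complex.Re (f y))) * (@cos R \o (fun y => complex.Im (f y)))).
    apply: is_derive_eq; rewrite /GRing.scale /= /Cexp.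
    by case: l {f1 f2 dE dc ds} => ? ? /=; ring.
  by apply/funext => y; rewrite fctE /Cexp /=; ring.
rewrite (_ : (fun y => _) = (expR \o (fun y => complex.Re (f y))) * (@sin R \o (fun y => complex.Im (f y)))).
  apply: is_derive_eq; rewrite /GRing.scale /= /Cexp.
  by case: l {f1 f2 dE dc ds} => ? ? /=; ring.
by apply/funext => y; rewrite fctE /Cexp /=; ring.
Qed.

Lemma cderive_sum N (f : 'I_N -> R -> C) x (l : 'I_N -> C) :
  (forall i, cderive (f i) x (l i)) -> cderive (fun y => \sum_(i < N) f i y) x (\sum_(i < N) l i).
Proof.
elim: N f l => [|N IH] f l fl.
  rewrite big_ord0 (_ : (fun y => _) = fun=> 0); first exact: cderive_cst.
  by apply/funext => y; rewrite big_ord0.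
rewrite big_ord_recr (_ : (fun y => _) = fun y => \sum_(i < N) f (widen_ord (leqnSn N) i) y + f ord_max y).
  by apply: cderiveD => //; apply: IH => i.
by apply/funext => y; rewrite big_ord_recr.
Qed.

End ComplexDerivative.

(** * Complex powers as power series in the exponent *)

Section ComplexPowers.
Variable R : realType.
Local Notation C := R[i].
Implicit Types (x w r : R) (z l a t s : C).

Lemma CexpD z l : Cexp (z + l) = Cexp z * Cexp l.
Proof.
case: z l => x y [u v]; rewrite /Cexp /= expRD cosD sinD.
by rewrite -[(_ * _)%:C]/(Complex _ _); apply/eqP; rewrite eq_complex /=; apply/andP; split; apply/eqP; ring.
Qed.

Lemma Cexp0 : Cexp (0 : C) = 1.
Proof. by rewrite /Cexp /= expR0 cos0 sin0 mul1r. Qed.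

Lemma cabs_Cexp z : cabs (Cexp z) = expR (complex.Re z).
Proof.
rewrite /Cexp cabsM cabsR ger0_norm ?expR_ge0 //.
by rewrite /cabs /= cos2Dsin2 sqrtr1 mulr1.
Qed.

Lemma Cexp_natl n z : Cexp (n%:R * z) = Cexp z ^+ n.
Proof.
elim: n => [|n IH]; first by rewrite mul0r Cexp0.
by rewrite mulrS mulrDl mul1r CexpD IH exprS.
Qed.

Lemma Cexp_real x : Cexp x%:C = (expR x)%:C.
Proof. by rewrite /Cexp /= cos0 sin0 mulr1. Qed.

Lemma Re_scale x z : complex.Re (x%:C * z) = x * complex.Re z.
Proof. by case: z => u v /=; ring. Qed.

Lemma Re_sum N (F : 'I_N -> C) : complex.Re (\sum_(i < N) F i) = \sum_(i < N) complex.Re (F i).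
Proof.
elim: N F => [|N IH] F; first by rewrite !big_ord0.
by rewrite !big_ord_recr -IH /=; case: (F ord_max) (\sum_(_ < _) _) => ? ? [].
Qed.

(** Multiplying by th turns a modulus into a real part, to which the real
    Taylor bound applies. *)
Lemma complex_sign z : exists th, cabs th <= 1 /\ th * z = (cabs z)%:C.
Proof.
have [->|z0] := eqVneq z 0; first by exists 0; rewrite mul0r !cabs0.
exists ((cabs z)%:C / z); rewrite divfK // cabsM cabsV cabsR ger0_norm ?cabs_ge0 //.
by rewrite divff // gt_eqF // cabs_gt0.
Qed.

(** Apply the real Taylor bound to x |-> Re (th exp(x z)) on [0, 1]. *)
Lemma Cexp_taylor z K :
  cabs (Cexp z - \sum_(k < K) z ^+ k / k`!%:R) <= cabs z ^+ K * expR (cabs z) / K`!%:R.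
Proof.
have [th [th1 thE]] := complex_sign (Cexp z - \sum_(k < K) z ^+ k / k`!%:R).
pose f k (x : R) := th * (z ^+ k * Cexp (x%:C * z)).
have df k x : cderive (f k) x (f k.+1 x).
  have d1 : cderive (fun y : R => y%:C * z) x z.
    apply: cderive_eq (cderiveM (cderive_real (is_derive_id x 1)) (cderive_cst z x)) _.
    by rewrite mul1r mulr0 addr0.
  by apply: cderive_eq (cderiveZ th (cderiveZ (z ^+ k) (cderive_Cexp d1))) _; rewrite /f exprSr !mulrA.
have := @taylor_bound R (fun k x => complex.Re (f k x)) K (cabs z ^+ K * expR (cabs z))
  (fun k x _ => proj1 (df k x)) _ 1.
rewrite ler01 lexx expr1n mulr1 => /(_ _ isT) H.
have {}H := H _; rewrite -[leLHS]ger0_norm ?cabs_ge0 //.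
have -> : cabs (Cexp z - \sum_(k < K) z ^+ k / k`!%:R) =
    complex.Re (f 0%N 1) - \sum_(k < K) complex.Re (f k 0) * 1 ^+ k / k`!%:R.
  transitivity (complex.Re (th * (Cexp z - \sum_(k < K) z ^+ k / k`!%:R))).
    by rewrite thE.
  rewrite mulrBr mulr_sumr raddfB /= Re_sum /f expr0 !mul1r; congr (_ - _).
  apply: eq_bigr => k _; rewrite mul0r Cexp0 expr1n !mulr1.
  rewrite -(rmorph_nat (real_complex R)) -fmorphV mulrA mulrC Re_scale mulrC //.
apply: H => x /andP[x0 x1]; rewrite /f (le_trans (Re_le_cabs _)) // cabsM [cabs (z ^+ K * _)]cabsM cabsX.
have hx : cabs (Cexp (x%:C * z)) <= expR (cabs z).
  rewrite cabs_Cexp ler_expR Re_scale; have := Re_le_cabs z; rewrite ler_norml => /andP[_].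
  by have := cabs_ge0 z; nra.
have zK : 0 <= cabs z ^+ K by rewrite exprn_ge0 ?cabs_ge0.
rewrite -[leRHS]mul1r ler_pM ?mulr_ge0 ?cabs_ge0 ?ler_wpM2l //.
Qed.

Lemma Cexp_series z : ccvg (fun J => \sum_(j < J) z ^+ j / j`!%:R) (Cexp z).
Proof.
move=> e e0.
have /cvgrPdist_lt H := @cvg_exp_coeff R (cabs z).
have fexp0 := expR_gt0 (cabs z).
have [N _ NP] := H _ (divr_gt0 e0 fexp0).
exists N => n Nn; rewrite cabsBC (le_lt_trans (Cexp_taylor _ _)) //.
have := NP n Nn; rewrite /= sub0r normrN ger0_norm ?exp_coeff_ge0 ?cabs_ge0 //.
by rewrite /exp_coeff /= ltr_pdivlMr // mulrAC.
Qed.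

(** w^a for w > 0. *)
Definition cpow a w : C := Cexp (a * (ln w)%:C).

Lemma cpowD a l w : cpow (a + l) w = cpow a w * cpow l w.
Proof. by rewrite /cpow mulrDl CexpD. Qed.

Lemma cpow0 w : cpow 0 w = 1. Proof. by rewrite /cpow mul0r Cexp0. Qed.

Lemma cpow_nat n w : 0 < w -> cpow n%:R w = (w ^+ n)%:C.
Proof.
move=> w0; rewrite /cpow Cexp_natl Cexp_real lnK ?posrE //.
by rewrite -rmorphXn.
Qed.

Lemma cabs_cpow a w : cabs (cpow a w) = expR (complex.Re a * ln w).
Proof. by rewrite /cpow cabs_Cexp mulrC Re_scale mulrC. Qed.

(** The coefficient of t^j in w^(a - t). *)
Definition pow_coef a w j : C := cpow a w * ((- ln w) ^+ j / j`!%:R)%:C.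

Lemma pow_coef_repr a w t : ccvg (fun J => \sum_(j < J) pow_coef a w j * t ^+ j) (cpow (a - t) w).
Proof.
have -> : cpow (a - t) w = cpow a w * Cexp (- t * (ln w)%:C) by rewrite cpowD.
apply: ccvg_ext (ccvgZ (cpow a w) (Cexp_series _)) => J.
rewrite mulr_sumr; apply: eq_bigr => j _; rewrite /pow_coef -mulrA; congr (_ * _).
have -> : - t * (ln w)%:C = (- ln w)%:C * t by rewrite rmorphN /=; ring.
by rewrite exprMn rmorphM rmorphXn /= fmorphV rmorph_nat mulrAC.
Qed.

Lemma sum_exp_le x J : 0 <= x -> \sum_(j < J) x ^+ j / j`!%:R <= expR x.
Proof.
move=> x0; have := @nondecreasing_cvgn_le R (series (exp_coeff x)) _ (is_cvg_series_exp_coeff x) J.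
rewrite /series /= big_mkord; apply.
apply: nondecreasing_series => n _ _; exact: exp_coeff_ge0.
Qed.

(** For w >= 1 the coefficients have modulus w^(Re a) (ln w)^j / j!, and the
    l1 norm on the disc of radius r is w^(Re a + r). *)
Lemma pow_coef_l1 r a w J : 0 <= r -> 1 <= w ->
  \sum_(j < J) cabs (pow_coef a w j) * r ^+ j <= expR ((complex.Re a + r) * ln w).
Proof.
move=> r0 w1; have l0 := ln_ge0 w1.
rewrite mulrDl expRD (le_trans _ (ler_wpM2l (expR_ge0 _) (sum_exp_le J (mulr_ge0 r0 l0)))) //.
rewrite mulr_sumr ler_sum // => j _; rewrite /pow_coef cabsM cabs_cpow cabsR -mulrA ler_wpM2l ?expR_ge0 //.
rewrite normrM normrX normrN (ger0_norm l0) ger0_norm ?invr_ge0 // exprMn.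
by rewrite mulrAC [_ * r ^+ j]mulrC.
Qed.

Lemma pow_coef_cderive a w j : 0 < w ->
  cderive (fun w => pow_coef a w j) w (mul_lin a (pow_coef (a - 1) w) j).
Proof.
move=> w0; have dl := is_derive1_ln w0.
have dpw : cderive (cpow a) w (a * cpow (a - 1) w).
  apply: cderive_eq (cderive_Cexp (cderiveZ a (cderive_real dl))) _.
  rewrite -[Cexp _]/(cpow a w) cpowD -mulrA [_ * cpow a w]mulrC; congr (_ * (_ * _)).
  by rewrite /cpow mulN1r -rmorphN Cexp_real -lnV ?posrE // lnK ?posrE ?invr_gt0.
have dn : is_derive w 1 (fun w => - ln w) (- w^-1) by apply: is_deriveN.
have pwV : cpow (a - 1) w = cpow a w * (w^-1)%:C.
  by rewrite cpowD; congr (_ * _); rewrite /cpow mulN1r -rmorphN Cexp_real -lnV ?posrE // lnK ?posrE ?invr_gt0.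
have dx : cderive (fun w => ((- ln w) ^+ j / j`!%:R)%:C) w
   (- (w^-1)%:C * (if j is j'.+1 then ((- ln w) ^+ j' / j'`!%:R)%:C else 0)).
  have dX : is_derive w 1 (j`!%:R^-1 *: ((fun w => - ln w) ^+ j))
      (j`!%:R^-1 *: ((j%:R * (- ln w) ^+ j.-1) *: (- w^-1))).
    exact: is_deriveZ _ _ (is_deriveX j dn).
  have {}dX : is_derive w 1 (fun w => (- ln w) ^+ j / j`!%:R)
      (j`!%:R^-1 *: ((j%:R * (- ln w) ^+ j.-1) *: (- w^-1))).
    by move: dX; congr is_derive; apply/funext => y; rewrite fctE mulrC.
  apply: cderive_eq (cderive_real dX) _; case: j {dX} => [|j].
    by rewrite mulr0 !mul0r scale0r scaler0.
  rewrite -rmorphN -rmorphM; congr (_%:C); rewrite /GRing.scale /= factS natrM.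
  have a0 : j.+1%:R != 0 :> R by rewrite pnatr_eq0.
  have f0 : j`!%:R != 0 :> R by rewrite pnatr_eq0 -lt0n fact_gt0.
  have w0' : w != 0 by rewrite gt_eqF.
  by move: a0 f0; move: j.+1%:R j`!%:R => c f a0 f0; field; rewrite a0 f0 w0'.
apply: cderive_eq (cderiveM dpw dx) _; rewrite /mul_lin /shiftc /pow_coef; case: j {dx} => [|j].
  by rewrite mulr0 !mulr0 addr0 subr0 mulrA.
by rewrite pwV; ring.
Qed.

(** The coefficients in t of the k-th derivative of w^(a - t) with respect
    to w. *)
Fixpoint dpow_coef k a w : nat -> C :=
  if k is k'.+1 then mul_lin a (dpow_coef k' (a - 1) w) else pow_coef a w.

(** The falling factorial of a complex number. *)
Definition cffact k a : C := \prod_(i < k) (a - i%:R).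

Lemma cffactS k a : cffact k.+1 a = a * cffact k (a - 1).
Proof.
rewrite /cffact big_ord_recl subr0; congr (_ * _); apply: eq_bigr => i _.
by rewrite lift0 -natr1 opprD addrCA addrC.
Qed.

Lemma mul_lin_cderive a (c : R -> nat -> C) (c' : nat -> C) w :
  (forall j, cderive (fun w => c w j) w (c' j)) ->
  forall j, cderive (fun w => mul_lin a (c w) j) w (mul_lin a c' j).
Proof.
move=> dc j; rewrite /mul_lin; case: j => [|j] /=.
  by apply: cderive_eq (cderiveD (cderiveZ a (dc 0%N)) (cderive_cst (- 0) w)) _; rewrite subr0 addr0.
have := cderiveD (cderiveZ a (dc j.+1)) (cderiveZ (-1) (dc j)); rewrite mulN1r.
by congr (cderive _ _ _); apply/funext => y; rewrite mulN1r.
Qed.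

Lemma dpow_coef_cderive k a w j : 0 < w -> cderive (fun w => dpow_coef k a w j) w (dpow_coef k.+1 a w j).
Proof.
move=> w0; elim: k a j => [|k IH] a j; first exact: pow_coef_cderive.
by apply: mul_lin_cderive => j'; apply: IH.
Qed.

Definition ffact_bound k a r := \prod_(i < k) (cabs (a - i%:R) + r).

Lemma dpow_coef_l1 k r a w J : 0 <= r -> 1 <= w ->
  \sum_(j < J) cabs (dpow_coef k a w j) * r ^+ j <=
  ffact_bound k a r * expR ((complex.Re a - k%:R + r) * ln w).
Proof.
move=> r0 w1; elim: k a J => [|k IH] a J.
  by rewrite /ffact_bound big_ord0 mul1r subr0; apply: pow_coef_l1.
rewrite (le_trans (l1_mul_lin a r0 (IH (a - 1)) J)) //.
rewrite /ffact_bound big_ord_recl subr0 -mulrA ler_wpM2l ?addr_ge0 ?cabs_ge0 //.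
rewrite le_eqVlt; apply/orP; left; apply/eqP; congr (_ * expR (_ * _)).
  by apply: eq_bigr => i _; rewrite lift0 -natr1 opprD addrCA addrC.
by rewrite -natr1; case: (a) => u v /=; ring.
Qed.

Lemma dpow_coef_repr k a w t :
  ccvg (fun J => \sum_(j < J) dpow_coef k a w j * t ^+ j) (cffact k (a - t) * cpow (a - t - k%:R) w).
Proof.
elim: k a => [|k IH] a; first by rewrite /cffact big_ord0 mul1r subr0; apply: pow_coef_repr.
have := ccvg_mul_lin a (IH (a - 1)).
rewrite cffactS mulrA; have -> : a - t - 1 = a - 1 - t by ring.
by have -> : a - t - k.+1%:R = a - 1 - t - k%:R by rewrite -natr1; ring.
Qed.

Lemma dpow_coef_expands k r a s0 w : 0 <= r -> 1 <= w ->
  expands r (ffact_bound k (a - s0) r * expR ((complex.Re (a - s0) - k%:R + r) * ln w))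
    (dpow_coef k (a - s0) w) (fun s => cffact k (a - s) * cpow (a - s - k%:R) w) s0.
Proof.
move=> r0 w1; split=> [J|t _]; first exact: dpow_coef_l1.
by rewrite opprD addrA; apply: dpow_coef_repr.
Qed.

End ComplexPowers.

(** * The remainder of the telescoping sum *)

Section Remainder.
Variable R : realType.
Local Notation C := R[i].
Implicit Types (x w r e : R) (z l a t s : C).

(** Weierstrass' theorem on sums of analytic functions, for l1 norms: the
    double series of coefficients is absolutely summable, so it may be summed
    in either order. *)
Lemma sum_expands (c : nat -> nat -> C) (f : nat -> C -> C) (F : C -> C) s0 r
    (B : nat -> R) (M : R) :
  0 < r -> (forall m, expands r (B m) (c m) (f m) s0) ->
  (forall N, \sum_(m < N) B m <= M) ->
  (forall t, cabs t <= r -> ccvg (fun N => \sum_(m < N) f m (s0 + t)) (F (s0 + t))) ->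
  exists b, expands r M b F s0.
Proof.
move=> r0 cf BM fF.
have B0 m : 0 <= B m by have := proj1 (cf m) 0%N; rewrite big_ord0.
have [S [SM Sge SB]] := bounded_series B0 BM.
have rj j : 0 < r ^+ j by rewrite exprn_gt0.
have cB m j : cabs (c m j) <= B m / r ^+ j.
  rewrite ler_pdivlMr // (le_trans _ (proj1 (cf m) j.+1)) // big_ord_recr /= lerDr.
  by apply: sumr_ge0 => i _; rewrite mulr_ge0 ?cabs_ge0 // ltW.
have BS j N : \sum_(m < N) B m / r ^+ j <= S / r ^+ j.
  by rewrite -mulr_suml ler_wpM2r ?invr_ge0 // ltW.
have /choice[a aP] : forall j, exists l, ccvg (fun N => \sum_(m < N) c m j) l.
  by move=> j; apply: abs_ccvg (fun m => cB m j) (BS j).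
exists a; split=> [J|t tr].
  apply/ler_addgt0Pr => e e0.
  have e1 : 0 < e / J.+1%:R by rewrite divr_gt0.
  have [N NP] := SB _ e1; have {NP} := NP N (leqnn N); set q := _ - _ => qe.
  have q0 : 0 <= q by rewrite subr_ge0.
  apply: (@le_trans _ _ (\sum_(j < J) (cabs (\sum_(m < N) c m j) * r ^+ j + q))).
    apply: ler_sum => j _; rewrite -ler_pdivlMr // mulrDl mulfK ?gt_eqF //.
    have := abs_tail_lim N (fun m => cB m j) (BS j) (aP j).
    rewrite -mulr_suml -mulrBl -/q => h.
    have -> : a j = (\sum_(m < N) c m j) + (a j - \sum_(m < N) c m j) by ring.
    by rewrite (le_trans (cabsD _ _)) // lerD.
  rewrite big_split /= lerD //.
    apply: (@le_trans _ _ (\sum_(j < J) \sum_(m < N) cabs (c m j) * r ^+ j)).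
      apply: ler_sum => j _; rewrite -mulr_suml ler_wpM2r ?cabs_sum //; exact: ltW.
    rewrite exchange_big /= (le_trans _ (BM N)) // ler_sum // => m _.
    exact: (proj1 (cf m)).
  rewrite sumr_const card_ord -mulr_natl.
  rewrite ltr_pdivlMr // in qe; rewrite (le_trans _ (ltW qe)) // mulrC ler_wpM2l // ler_nat leqnSn //.
move=> e e0; have e3 : 0 < e / 3 by lra.
have [N NP] := SB _ e3; have {NP} qe := NP N (leqnn N).
have PB m J : cabs (\sum_(j < J) c m j * t ^+ j) <= B m.
  rewrite (le_trans (cabs_sum _ _ _)) // (le_trans _ (proj1 (cf m) J)) // ler_sum // => j _.
  by rewrite cabsM cabsX ler_wpM2l ?cabs_ge0 // lerXn2r // nnegrE ?cabs_ge0 // ltW.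
have fB m : cabs (f m (s0 + t)) <= B m.
  rewrite -[f m _]subr0; apply: (ccvg_le (proj2 (cf m) t tr) (N := 0%N)) => J _.
  by rewrite subr0.
(* Three errors: the tail in m of the sum of functions, the tails in j of the
   first N functions, and the tail in m of the partial sums up to J. *)
have h1 := abs_tail_lim N fB Sge (fF t tr).
have /(_ _ e3)[J0 J0P] := @ccvg_sumord R N (fun m J => \sum_(j < J) c m j * t ^+ j)
   (fun m => f m (s0 + t)) (fun m => proj2 (cf m) t tr).
exists J0 => J JJ; have h2 := J0P _ JJ.
have cvJ : ccvg (fun N' => \sum_(m < N') \sum_(j < J) c m j * t ^+ j) (\sum_(j < J) a j * t ^+ j).
  have := @ccvg_sumord R J (fun j N' => t ^+ j * \sum_(m < N') c m j) (fun j => t ^+ j * a j)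
    (fun j => ccvgZ (t ^+ j) (aP j)).
  under [X in ccvg _ X -> _]eq_bigr do rewrite mulrC.
  apply: ccvg_ext => N'; rewrite exchange_big; apply: eq_bigr => j _.
  by rewrite mulrC mulr_suml.
have h3 := abs_tail_lim N (fun m => PB m J) Sge cvJ.
set A := \sum_(j < J) a j * t ^+ j in h3 *; set P := \sum_(m < N) \sum_(j < J) _ in h2 h3.
set Q := \sum_(i < N) _ in h1; set F0 := F _ in h1 *.
have -> : A - F0 = (A - P) + (P - Q) - (F0 - Q) by ring.
have := cabsD (A - P + (P - Q)) (- (F0 - Q)); have := cabsD (A - P) (P - Q); rewrite cabsN.
by rewrite -/Q in h2; lra.
Qed.

(** 2/k! for odd k and 0 for even k: the coefficients of 2 sinh. *)
Definition odd_coef k : C := (1 - (-1) ^+ k) / k`!%:R.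

Definition cdiff_rem_coef K a (n : R) j : C :=
  dpow_coef 0 a (n + 1) j - dpow_coef 0 a (n - 1) j - \sum_(k < K) odd_coef k * dpow_coef k a n j.

Lemma cderive_affine (f : R -> C) n x d l :
  cderive f (n + d * x) l -> cderive (fun y => f (n + d * y)) x (d%:C * l).
Proof.
have da : is_derive x 1 (fun y => n + d * y) d.
  have -> : (fun y => n + d * y) = cst n + d *: @id R by apply/funext => y; rewrite fctE.
  have := is_deriveD (is_derive_cst n x 1) (is_deriveZ d (is_derive_id x (1 : R))).
  by move=> /is_derive_eq; apply; rewrite add0r /GRing.scale /= mulr1.
move=> [f1 f2]; split.
  rewrite Re_scale mulrC.
  exact: (@is_derive1_comp R (fun y => complex.Re (f y)) (fun y => n + d * y) x _ _ f1 da).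
have -> : complex.Im (d%:C * l) = complex.Im l * d by case: (l) => u v /=; ring.
exact: (@is_derive1_comp R (fun y => complex.Im (f y)) (fun y => n + d * y) x _ _ f2 da).
Qed.

(** Taylor's bound for w^(a - t) between n and n + d, with values in the
    space of power series in t with the l1 norm on the disc of radius r. Choosing
    for every j a th_j with th_j c_j = |c_j| reduces the norm of the
    remainder to one real function. The K-th derivative is of size
    w^(Re a - K + r), hence at most w^(-2) <= (n - 1)^(-2) between n - 1 and
    n + 1. *)
Lemma dpow_coef_taylor K a n d r J : `|d| = 1 -> 0 <= r -> 2 <= n ->
  complex.Re a - K%:R + r <= - 2 ->
  \sum_(j < J) cabs (dpow_coef 0 a (n + d) j - \sum_(k < K) (d%:C ^+ k / k`!%:R) * dpow_coef k a n j) * r ^+ j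
    <= ffact_bound K a r * (n - 1) ^- 2.
Proof.
move=> d1 r0 n2 aK.
pose Rm j := dpow_coef 0 a (n + d) j - \sum_(k < K) (d%:C ^+ k / k`!%:R) * dpow_coef k a n j.
have /choice[th thP] := fun j => complex_sign (Rm j).
(* f 0 is the functional with weights th_j r^j, applied to the coefficients of
   (n + d x)^(a - t), and f k is its k-th derivative in x *)
pose f k (x : R) := \sum_(j < J) (th j * (r ^+ j)%:C * d%:C ^+ k) * dpow_coef k a (n + d * x) j.
have ge1 x : 0 <= x <= 1 -> n - 1 <= n + d * x.
  by move=> /andP[x0 x1]; rewrite lerD2l -lerN2 opprK (le_trans (ler_norm _)) // normrN normrM d1 mul1r ger0_norm.
have df k x : 0 <= x <= 1 -> cderive (f k) x (f k.+1 x).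
  move=> x01; have w0 : 0 < n + d * x by have := ge1 x x01; lra.
  apply: cderive_sum => j.
  apply: cderive_eq (cderiveZ _ (cderive_affine (dpow_coef_cderive k a j w0))) _.
  by rewrite exprS; ring.
have F0 : 0 <= ffact_bound K a r by apply: prodr_ge0 => i _; rewrite addr_ge0 ?cabs_ge0.
have := @taylor_bound R (fun k x => complex.Re (f k x)) K (ffact_bound K a r * (n - 1) ^- 2)
  (fun k x h => proj1 (df k x h)) _ 1.
rewrite ler01 lexx expr1n mulr1 => H.
have {H} : `|complex.Re (f 0%N 1) - \sum_(k < K) complex.Re (f k 0) * 1 ^+ k / k`!%:R|
     <= ffact_bound K a r * (n - 1) ^- 2 / K`!%:R.
  apply: H => // x x01; rewrite (le_trans (Re_le_cabs _)) // (le_trans (cabs_sum _ _ _)) //.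
  have w1 : 1 <= n + d * x by have := ge1 x x01; lra.
  apply: (@le_trans _ _ (\sum_(j < J) cabs (dpow_coef K a (n + d * x) j) * r ^+ j)).
    apply: ler_sum => j _; rewrite !cabsM cabsX !cabsR d1 expr1n mulr1 ger0_norm ?exprn_ge0 //.
    rewrite mulrC ler_wpM2l ?cabs_ge0 // -[leRHS]mul1r ler_wpM2r ?exprn_ge0 //.
    by case: (thP j).
  rewrite (le_trans (dpow_coef_l1 K a J r0 w1)) // ler_wpM2l //.
  have n1 : 0 < n - 1 by lra.
  have -> : (n - 1) ^- 2 = expR (- 2 * ln (n - 1)).
    by rewrite mulNr expRN expRM_natl lnK.
  rewrite ler_expR; have l0 := ln_ge0 w1.
  have : ln (n - 1) <= ln (n + d * x) by rewrite ler_ln ?posrE ?ge1 //; lra.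
  nra.
have -> : complex.Re (f 0%N 1) - \sum_(k < K) complex.Re (f k 0) * 1 ^+ k / k`!%:R =
   \sum_(j < J) cabs (Rm j) * r ^+ j.
  transitivity (complex.Re (\sum_(j < J) (r ^+ j)%:C * (th j * Rm j))).
    have -> : \sum_(j < J) (r ^+ j)%:C * (th j * Rm j) =
       f 0%N 1 - \sum_(k < K) (k`!%:R^-1)%:C * f k 0.
      rewrite /f; under [X in _ - X]eq_bigr do rewrite mulr_sumr.
      rewrite exchange_big /= -sumrB; apply: eq_bigr => j _.
      rewrite /Rm !mulrBr expr0 !mulr1; congr (_ - _); first by rewrite /=; ring.
      rewrite !mulr_sumr; apply: eq_bigr => k _.
      by rewrite mulr0 addr0 fmorphV rmorph_nat; ring.
    rewrite raddfB /=; congr (_ - _); rewrite Re_sum; apply: eq_bigr => k _.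
    by rewrite Re_scale expr1n mulr1 mulrC.
  rewrite Re_sum; apply: eq_bigr => j _; rewrite Re_scale; have [_ ->] := thP j.
  by rewrite mulrC.
move=> H; have {H} := le_trans (ler_norm _) H; move/le_trans; apply.
rewrite ler_pdivrMr ?ltr0n ?fact_gt0 // ler_peMr //; last by rewrite ler1n fact_gt0.
by rewrite mulr_ge0 // invr_ge0 exprn_ge0 //; lra.
Qed.

(** (n+1)^(1-s) - (n-1)^(1-s) minus the odd part, doubled, of the Taylor
    polynomial of y |-> (n + y)^(1-s) at y = 0, evaluated at y = 1. *)
Definition cdiff_rem K (n : R) s : C :=
  cpow (1 - s) (n + 1) - cpow (1 - s) (n - 1)
  - \sum_(k < K) odd_coef k * (cffact k (1 - s) * cpow (1 - s - k%:R) n).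

Lemma cdiff_rem_expands K n r s0 : 0 <= r -> 2 <= n -> complex.Re (1 - s0) - K%:R + r <= - 2 ->
  expands r (2 * (ffact_bound K (1 - s0) r * (n - 1) ^- 2)) (cdiff_rem_coef K (1 - s0) n) (cdiff_rem K n) s0.
Proof.
move=> r0 n2 h; split=> [J|t _].
  have h1 := dpow_coef_taylor J (normr1 R) r0 n2 h.
  have h2 := dpow_coef_taylor J (normrN1 R) r0 n2 h.
  rewrite mulr_natl mulr2n (le_trans _ (lerD h1 h2)) // -big_split /= ler_sum // => j _.
  rewrite -mulrDl ler_wpM2r ?exprn_ge0 // -[X in _ <= _ + X]cabsN.
  rewrite (le_trans _ (cabsD _ _)) // le_eqVlt; apply/orP; left; apply/eqP; congr cabs.
  rewrite /cdiff_rem_coef; have -> : \sum_(k < K) odd_coef k * dpow_coef k (1 - s0) n j =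
      \sum_(k < K) (1%:C ^+ k / k`!%:R) * dpow_coef k (1 - s0) n j -
      \sum_(k < K) ((-1)%:C ^+ k / k`!%:R) * dpow_coef k (1 - s0) n j.
    rewrite -sumrB; apply: eq_bigr => k _.
    by rewrite rmorphN1 expr1n /odd_coef; ring.
  have regroup (S1 S2 A A' : C) : A - A' - (S1 - S2) = A - S1 - (A' - S2) by ring.
  exact: regroup.
rewrite /cdiff_rem opprD addrA.
have P k w := dpow_coef_repr k (1 - s0) w t.
have P0 w : ccvg (fun J => \sum_(j < J) dpow_coef 0 (1 - s0) w j * t ^+ j) (cpow (1 - s0 - t) w).
  by have := P 0%N w; rewrite /cffact big_ord0 mul1r subr0.
have PK := @ccvg_sumord R K (fun k J => odd_coef k * \sum_(j < J) dpow_coef k (1 - s0) n j * t ^+ j) _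
  (fun k => ccvgZ (odd_coef k) (P k n)).
have := ccvgD (ccvgD (P0 (n + 1)) (ccvgZ (-1) (P0 (n - 1)))) (ccvgZ (-1) PK).
rewrite !mulN1r; apply: ccvg_ext => J.
under [in RHS]eq_bigr do rewrite /cdiff_rem_coef !mulrBl.
rewrite !sumrB !mulN1r; congr (_ - _).
under [in RHS]eq_bigr do rewrite mulr_suml.
rewrite exchange_big; apply: eq_bigr => k _ /=; rewrite mulr_sumr.
by apply: eq_bigr => j _; rewrite mulrA.
Qed.

(** The sum over n >= 2 of the remainders, where it converges. Starting at 2
    keeps n - 1 positive. *)
Definition zeta_rem K s : C := xget 0 [set l | ccvg (fun M => \sum_(m < M) cdiff_rem K m.+2%:R s) l].

Lemma zeta_rem_eq K s l : ccvg (fun M => \sum_(m < M) cdiff_rem K m.+2%:R s) l -> zeta_rem K s = l.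
Proof.
move=> cv; rewrite /zeta_rem; case: xgetP => [y _ /= cy|/(_ l)]; first exact: ccvg_unique cy cv.
by move=> /(_ cv).
Qed.

Lemma sum_inv_sqr N : \sum_(m < N) (m.+1%:R : R) ^- 2 <= 2.
Proof.
case: N => [|N]; first by rewrite big_ord0.
suff : \sum_(m < N.+1) (m.+1%:R : R) ^- 2 <= 2 - N.+1%:R^-1.
  have i0 : 0 < (N.+1%:R : R)^-1 by rewrite invr_gt0.
  by move=> /le_trans; apply; rewrite lerBlDr lerDl ltW.
elim: N => [|N IH]; first by rewrite big_ord1 /= mulr1n expr1n invr1; lra.
rewrite big_ord_recr /=; have x0 : 0 < N.+1%:R :> R by [].
rewrite (le_trans (lerD IH (lexx _))) // -[N.+2%:R]natr1.
set x := N.+1%:R in x0 *; rewrite -subr_ge0.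
have -> : 2 - (x + 1)^-1 - (2 - x^-1 + (x + 1) ^- 2) = x^-1 * (x + 1) ^- 2.
  by field; apply/andP; split; rewrite gt_eqF //; lra.
by rewrite mulr_ge0 // invr_ge0 ?exprn_ge0 //; lra.
Qed.

(** The remainders are dominated on the unit disc around s0 by a multiple of
    the convergent series of (n - 1)^(-2). *)
Lemma zeta_rem_ana K s0 : 4 <= complex.Re s0 + K%:R -> ana (zeta_rem K) s0.
Proof.
move=> h; pose B m : R := 2 * (ffact_bound K (1 - s0) 1 * m.+1%:R ^- 2).
have F0 : 0 <= ffact_bound K (1 - s0) 1 by apply: prodr_ge0 => i _; rewrite addr_ge0 ?cabs_ge0.
have BM N : \sum_(m < N) B m <= 2 * (ffact_bound K (1 - s0) 1 * 2).
  by rewrite -!mulr_sumr !ler_wpM2l // sum_inv_sqr.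
have ex m : expands 1 (B m) (cdiff_rem_coef K (1 - s0) m.+2%:R) (cdiff_rem K m.+2%:R) s0.
  have := @cdiff_rem_expands K m.+2%:R 1 s0 ler01; rewrite -[m.+2%:R]natr1 addrK natr1; apply.
    by rewrite ler_nat.
  by case: (s0) h => u v /=; lra.
have [t t1|b bP] := @sum_expands _ _ (zeta_rem K) s0 1 B _ ltr01 ex BM.
  have fB m : cabs (cdiff_rem K m.+2%:R (s0 + t)) <= B m.
    rewrite -[cdiff_rem _ _ _]subr0; apply: (ccvg_le (proj2 (ex m) t t1) (N := 0%N)) => J _.
    rewrite subr0 (le_trans (cabs_sum _ _ _)) // (le_trans _ (proj1 (ex m) J)) // ler_sum // => j _.
    by rewrite cabsM cabsX ler_wpM2l ?cabs_ge0 // lerXn2r // nnegrE ?cabs_ge0.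
  by have [l cv] := abs_ccvg fB BM; rewrite (zeta_rem_eq cv).
by exists 1, (2 * (ffact_bound K (1 - s0) 1 * 2)), b.
Qed.

Lemma cffact_nat k N : cffact k N%:R = (N ^_ k)%:R :> C.
Proof.
elim: k N => [|k IH] N; first by rewrite /cffact big_ord0.
rewrite cffactS; case: N => [|N]; first by rewrite mul0r.
by rewrite -natr1 addrK natr1 IH ffactSS natrM.
Qed.

Lemma odd_coef_cffact k N : odd_coef k * cffact k N%:R = (1 - (-1) ^+ k) * 'C(N, k)%:R :> C.
Proof.
rewrite cffact_nat -bin_ffact natrM /odd_coef; field.
by rewrite pnatr_eq0 -lt0n fact_gt0.
Qed.

(** For s = 1 - N the Taylor polynomial of (n + y)^N is exact. *)
Lemma zeta_rem_nat K N : (N < K)%N -> zeta_rem K (1 - N%:R) = 0.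
Proof.
move=> NK; apply: zeta_rem_eq; apply: ccvg_ext (ccvg_cst 0) => M; rewrite big1 // => m _.
have -> : m.+2%:R = m.+1%:R + 1 :> R by rewrite natr1.
rewrite /cdiff_rem addrK (_ : 1 - (1 - N%:R) = N%:R); last by ring.
set x : R := m.+1%:R; have x0 : 0 < x by [].
rewrite !cpow_nat ?addr_gt0 //.
rewrite -(subnKC NK) big_split_ord /= [X in _ - (_ + X)]big1 => [|k _]; last first.
  by rewrite cffact_nat ffact_small ?mul0r ?mulr0 // leq_addr.
rewrite addr0.
under eq_bigr => k _.
  have kN : (k <= N)%N by rewrite -ltnS.
  rewrite mulrA odd_coef_cffact -natrB // cpow_nat ?addr_gt0 //.
  over.
have e1 : (x + 1 + 1)%:C = (x + 1)%:C + 1 by rewrite [LHS]rmorphD.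
have e2 : x%:C = (x + 1)%:C - 1 by rewrite rmorphD /= addrK.
rewrite !rmorphXn /= e1 e2 !exprDn -sumrB; apply/eqP; rewrite subr_eq0; apply/eqP.
by apply: eq_bigr => k _; rewrite expr1n rmorphXn /= -[X in X - _]mulr_natr -[X in _ - X]mulr_natr; ring.
Qed.

End Remainder.

(** * Zeta at the negative odd integers *)

Section ZetaValues.
Variable R : realType.
Local Notation C := R[i].
Variable zeta : C -> C.
Hypothesis zetaP : is_riemann_zeta zeta.
Implicit Types (s t a : C).

Lemma zeta_ana s0 k : s0 + k != 1 -> ana (fun s => zeta (s + k)) s0.
Proof. by move=> h; apply: ana_shift; apply: ana_of_analytic; apply: (proj1 zetaP). Qed.

Lemma Re_nat n : complex.Re (n%:R : C) = n%:R.
Proof. by rewrite -(rmorph_nat (real_complex R)). Qed.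

Lemma zeta_series s : 1 < complex.Re s ->
  ccvg (fun M => \sum_(m < M) cpow (- s) m.+1%:R) (zeta s).
Proof.
move=> s1; have := ccvg_of_cvg (proj2 zetaP s s1).
by apply: ccvg_ext => M; rewrite /series /= big_mkord.
Qed.

Lemma zeta_series2 s : 1 < complex.Re s ->
  ccvg (fun M => \sum_(m < M) cpow (- s) m.+2%:R) (zeta s - 1).
Proof.
move=> /zeta_series/(iffRL (ccvg_shift _ _ 1)) cv; have := ccvgD cv (ccvg_cst (- 1)).
apply: ccvg_ext => M; rewrite addn1 big_ord_recl /= {1}/cpow ln1 mulr0 Cexp0.
by rewrite addrC addKr.
Qed.

(** The terms of the convergent series for zeta(s - 1). *)
Lemma cpow_cvg0 s : 2 < complex.Re s -> ccvg (fun M => cpow (1 - s) M.+1%:R) 0.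
Proof.
move=> s2; have s1 : 1 < complex.Re (s - 1) by case: (s) s2 => u v /=; lra.
have cv := zeta_series s1; have cv1 := (iffRL (ccvg_shift _ _ 1) cv).
have := ccvgD cv1 (ccvgZ (-1) cv); rewrite mulN1r subrr; apply: ccvg_ext => M.
by rewrite addn1 big_ord_recr /= mulN1r addrAC subrr add0r opprB.
Qed.

(** The first term is the telescoping sum. The others are Dirichlet series
    without their first term, summed over n; the one with k = 0 would diverge
    but has coefficient 0. *)
Lemma zeta_rem_zeta K s : 2 < complex.Re s ->
  zeta_rem K s = - (1 + cpow (1 - s) 2)
    - \sum_(k < K) odd_coef R k * (cffact k (1 - s) * (zeta (s + (k%:R - 1)) - 1)).
Proof.
move=> s2; apply: zeta_rem_eq; set a := 1 - s.
(* the two boundary terms of the telescoping sum tend to 0 *)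
have tel : ccvg (fun M => \sum_(m < M) (cpow a m.+3%:R - cpow a m.+1%:R)) (- (1 + cpow a 2)).
  have c1 := cpow_cvg0 s2; have c2 := iffRL (ccvg_shift _ _ 1) c1.
  have := ccvgD (ccvgD c1 c2) (ccvg_cst (- (1 + cpow a 2))); rewrite !add0r.
  apply: ccvg_ext => M; elim: M => [|M IH].
    by rewrite big_ord0 /= {1}/cpow ln1 mulr0 Cexp0 subrr.
  by rewrite big_ord_recr /= -IH !addn1; ring.
have terms (k : 'I_K) : ccvg (fun M => \sum_(m < M) odd_coef R k * (cffact k a * cpow (a - k%:R) m.+2%:R))
    (odd_coef R k * (cffact k a * (zeta (s + (k%:R - 1)) - 1))).
  case: k => -[|k] kK /=.
    by rewrite {2}/odd_coef expr0 subrr !mul0r; apply: ccvg_ext (ccvg_cst 0) => M;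
      rewrite big1 // => m _; rewrite /odd_coef expr0 subrr !mul0r.
  have -> : a - k.+1%:R = - (s + (k.+1%:R - 1)) by rewrite /a; ring.
  have r1 : 1 < complex.Re (s + (k.+1%:R - 1)).
    rewrite -natr1 addrK; have := Re_nat k; case: (s) s2 (k%:R : C) => u v /= u2 [x y] /= ->.
    by rewrite (lt_le_trans (_ : 1 < u)) ?lerDl //; lra.
  have := ccvgZ (odd_coef R k.+1) (ccvgZ (cffact k.+1 a) (zeta_series2 r1)).
  by apply: ccvg_ext => M; rewrite !mulr_sumr.
have := ccvgD tel (ccvgZ (-1) (ccvg_sumord terms)); rewrite mulN1r.
apply: ccvg_ext => M; rewrite mulN1r exchange_big -sumrB; apply: eq_bigr => m _.
by rewrite /cdiff_rem -/a natr1 -[m.+2%:R]natr1 addrK.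
Qed.

Lemma ana_cffact k g s0 : ana g s0 -> ana (fun s => cffact k (1 - s) * g s) s0.
Proof.
move=> ga; elim: k => [|k IH].
  by apply: ana_ext ga => s; rewrite /cffact big_ord0 mul1r.
apply: ana_ext (ana_lin (1 - k%:R) IH) => s.
by rewrite /cffact big_ord_recr /=; ring.
Qed.

(** For Re s > 2 this is minus the sum in [zeta_rem_zeta], and it is analytic
    for Re s >= 4 - K, across the poles of the summands. *)
Definition zeta_sum K s := 1 + cpow (1 - s) 2 + zeta_rem K s.

Lemma zeta_sum_ana K s0 : 4 <= complex.Re s0 + K%:R -> ana (zeta_sum K) s0.
Proof.
move=> h; apply: anaD; last exact: zeta_rem_ana.
apply: anaD; first exact: ana_cst.
have w1 : 1 <= 2 :> R by rewrite ler1n.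
exists 1, (ffact_bound 0 (1 - s0) 1 * expR ((complex.Re (1 - s0) - 0%:R + 1) * ln 2)), (dpow_coef 0 (1 - s0) 2).
split=> //; have := dpow_coef_expands 0 1 s0 ler01 w1.
by congr (expands _ _ _ _ _); apply/funext => s; rewrite /cffact big_ord0 mul1r subr0.
Qed.

(** The continuation of (s - 1) (zeta s - 1) across s = 1, by the case K = 3. *)
Definition zeta_reg s := 2^-1 * zeta_sum 3 s.

Lemma odd_coef_even k : ~~ odd k -> odd_coef R k = 0.
Proof. by move=> /negbTE ek; rewrite /odd_coef -signr_odd ek expr0 subrr mul0r. Qed.

Lemma zeta_reg_zeta s : 2 < complex.Re s -> zeta_reg s = (s - 1) * (zeta s - 1).
Proof.
move=> s2; rewrite /zeta_reg /zeta_sum zeta_rem_zeta // !big_ord_recr big_ord0 /=.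
rewrite (@odd_coef_even 0) // (@odd_coef_even 2) // (_ : odd_coef R 1 = 2); last first.
  by rewrite /odd_coef expr1 opprK divr1.
rewrite cffactS (_ : s + (1%:R - 1) = s) ?mul0r; last by ring.
by rewrite [cffact 0 (_ - 1)]big_ord0; move: (cpow _ _) (zeta s) => P Z; field.
Qed.

Lemma zeta_reg1 : zeta_reg 1 = 1.
Proof.
rewrite /zeta_reg /zeta_sum subrr cpow0 -[X in zeta_rem _ X](subr0 1) (@zeta_rem_nat R 3 0) // addr0.
by field.
Qed.

(** The relation of [zeta_rem_zeta] with all terms on one side. In the term
    k = 2n+1, which has a pole at s = 1 - 2n, the product of the last factor of the
    falling factorial and the zeta value is replaced by [zeta_reg]; the term
    k = 2n+2 is zero, but K = 2n+3 is what makes the remainder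
    converge at s = 1 - 2n. *)
Definition zeta_defect n s := zeta_sum (n.*2 + 3) s
  + \sum_(k < n.*2.+1) odd_coef R k * (cffact k (1 - s) * (zeta (s + (k%:R - 1)) - 1))
  - odd_coef R n.*2.+1 * (cffact n.*2 (1 - s) * zeta_reg (s + n.*2%:R)).

Lemma zeta_defect_zero n s : 2 < complex.Re s -> zeta_defect n s = 0.
Proof.
move=> s2; rewrite /zeta_defect /zeta_sum zeta_rem_zeta // addnC !addSn add0n !big_ord_recr /=.
rewrite (@odd_coef_even n.*2.+2); last by rewrite /= odd_double.
rewrite zeta_reg_zeta; last first.
  have := Re_nat n.*2; case: (s) s2 (n.*2%:R : C) => u v /= u2 [x y] /= ->.
  by rewrite (lt_le_trans u2) // lerDl.
have -> : n.*2.+1%:R - 1 = n.*2%:R :> C by rewrite -natr1 addrK.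
rewrite [cffact n.*2.+1 _]big_ord_recr /= -/(cffact n.*2 (1 - s)).
by move: (odd_coef R) (cpow _ _) (zeta (s + _)) (cffact _ _) (n.*2%:R : C) => kk P Z Q N; ring.
Qed.

Lemma zeta_defect_ana n s0 : 1 - n.*2%:R <= complex.Re s0 ->
  (forall k, (k < n.*2.+1)%N -> s0 + (k%:R - 1) != 1) -> ana (zeta_defect n) s0.
Proof.
move=> h pole; apply: anaD; first apply: anaD.
- by apply: zeta_sum_ana; rewrite natrD; lra.
- apply: ana_sum => k; apply: anaZ; apply: ana_cffact; apply: anaD; last exact: ana_cst.
  by apply: zeta_ana; apply: pole.
- under eq_fun do rewrite -mulNr.
  apply: anaZ; apply: ana_cffact; apply: (@ana_shift R zeta_reg); apply: anaZ; apply: zeta_sum_ana.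
  have := Re_nat n.*2; case: (s0) h (n.*2%:R : C) => u v /= hu [x y] /= ->.
  by lra.
Qed.

(** The segment from 3 + i to 1 - 2n starts in the half plane Re s > 2, where
    the defect is zero, and is not real before its endpoint. *)
Lemma zeta_defect_eval n : zeta_defect n (1 - n.*2%:R) = 0.
Proof.
pose p : C := 3 +i* 1; pose v : C := (- (2 + n.*2%:R)) +i* (- 1).
have -> : 1 - n.*2%:R = p + v.
  rewrite -(rmorph_nat (real_complex R)) -(rmorph1 (real_complex R)) -rmorphB /=.
  by rewrite /p /v; apply/eqP; rewrite eq_complex /=; apply/andP; split; apply/eqP; ring.
have n0 : 0 <= n.*2%:R :> R by [].
have pt (x : R) : p + x%:C * v = (3 - x * (2 + n.*2%:R)) +i* (1 - x).
  by apply/eqP; rewrite eq_complex /=; apply/andP; split; apply/eqP; ring.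
have n2 : 0 < 2 + n.*2%:R :> R by lra.
apply: (@ana_segment _ _ _ _ (2 + n.*2%:R)^-1).
- by rewrite eq_complex /= negb_and oppr_eq0 [X in _ || ~~ X]oppr_eq0 oner_eq0 orbT.
- by rewrite invr_gt0.
- move=> x /andP[x0 x1]; rewrite pt; apply: zeta_defect_ana => [|k kn] /=; first nra.
  apply/negP => /eqP e; have := congr1 (@complex.Im R) e; have := congr1 (@complex.Re R) e.
  have := Re_nat k; have : complex.Im (k%:R : C) = 0.
    by rewrite -(rmorph_nat (real_complex R)).
  case: (k%:R : C) => u w /= -> -> h1 h2.
  have xe : x = 1 by lra.
  have : (k : nat)%:R = n.*2.+1%:R :> R by move: h1; rewrite xe mul1r -natr1 => h1; lra.
  by move/eqP; rewrite eqr_nat => /eqP ke; rewrite ke ltnn in kn.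
- move=> x /andP[x0 xd]; rewrite pt; apply: zeta_defect_zero => /=.
  by move: xd; rewrite -[X in x < X]mul1r ltr_pdivlMr //; lra.
Qed.

(** At s = 1 - 2n the falling factorials give binomial coefficients, whose sum
    over odd k, doubled, is 2^(2n), and [zeta_reg1] contributes
    2 (2n)!/(2n+1)!. *)
Lemma zeta_binomial n : (0 < n)%N ->
  \sum_(k < n.*2.+1) (1 - (-1) ^+ k) * 'C(n.*2, k)%:R * zeta (1 - (n.*2 - k).+1%:R) =
  2 / n.*2.+1%:R - 1.
Proof.
move=> n0; have := zeta_defect_eval n; rewrite /zeta_defect /zeta_sum.
have -> : 1 - (1 - n.*2%:R) = n.*2%:R :> C by ring.
rewrite subrK zeta_reg1 zeta_rem_nat; last by rewrite -addn1 leq_add2l.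
rewrite cpow_nat // mulr1 cffact_nat ffactnn addr0.
under eq_bigr => k _.
  have kn : (k <= n.*2)%N by rewrite -ltnS.
  have -> : 1 - n.*2%:R + (k%:R - 1) = 1 - (n.*2 - k).+1%:R :> C.
    by rewrite -natr1 natrB //; ring.
  rewrite mulrA odd_coef_cffact mulrBr mulr1.
  over.
rewrite sumrB.
have -> : \sum_(k < n.*2.+1) (1 - (-1) ^+ k) * 'C(n.*2, k)%:R = 2 ^+ n.*2 :> C.
  under eq_bigr do rewrite mulrBl.
  rewrite sumrB.
  have b1 := @exprDn C 1 1 n.*2; have b2 := @exprDn C 1 (-1) n.*2.
  transitivity ((1 + 1) ^+ n.*2 - (1 + -1) ^+ n.*2 : C).
    rewrite b1 b2; congr (_ - _); apply: eq_bigr => k _; rewrite !expr1n mul1r.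
      by rewrite mul1r.
    by rewrite mulr_natr.
  by rewrite [1 + -1]subrr expr0n double_eq0 eqn0Ngt n0 /= subr0.
have -> : odd_coef R n.*2.+1 * n.*2`!%:R = 2 / n.*2.+1%:R.
  have f0 : n.*2`!%:R != 0 :> C by rewrite pnatr_eq0 -lt0n fact_gt0.
  have a0 : n.*2.+1%:R != 0 :> C by rewrite pnatr_eq0.
  rewrite /odd_coef -signr_odd /= odd_double expr1 factS natrM.
  by move: f0 a0; move: (n.*2`!%:R : C) (n.*2.+1%:R : C) => f b f0 b0; field; rewrite f0 b0.
rewrite rmorphXn rmorph_nat; set S := \sum_(k < _) _; set q := 2 / _ => e.
have -> : S = 1 + 2 ^+ n.*2 + (S - 2 ^+ n.*2) - q + q - 1 by ring.
by rewrite e; ring.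
Qed.

Lemma zeta_recurrence n : (0 < n)%N ->
  \sum_(k < n) zeta (1 - (k.+1.*2)%:R) / ((k.*2.+1)`!%:R * ((n - k).*2.-1)`!%:R) =
  (n.*2.+1)`!%:R^-1 - (2 * (n.*2)`!%:R)^-1.
Proof.
move=> n0; have fN m : m`!%:R != 0 :> C by rewrite pnatr_eq0 -lt0n fact_gt0.
have key : 2 * (n.*2)`!%:R * (\sum_(k < n) zeta (1 - (k.+1.*2)%:R) /
   ((k.*2.+1)`!%:R * ((n - k).*2.-1)`!%:R)) = 2 / n.*2.+1%:R - 1.
  rewrite -zeta_binomial // mulr_sumr.
  pose g j : C := if odd j then 2 * 'C(n.*2, j)%:R * zeta (1 - j.+1%:R) else 0.
  transitivity (\sum_(j < n.*2.+1) g j).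
    rewrite big_ord_recl add0r.
    transitivity (\sum_(j < n.*2) (if odd j then 0 else 2 * 'C(n.*2, j.+1)%:R * zeta (1 - j.+2%:R))).
      rewrite (big_even (fun j => 2 * 'C(n.*2, j.+1)%:R * zeta (1 - j.+2%:R))).
      rewrite uphalf_double; apply: eq_bigr => k _; rewrite doubleS.
      have kn := ltn_ord k.
      have -> : ('C(n.*2, k.*2.+1))%:R = n.*2`!%:R / ((k.*2.+1)`!%:R * ((n - k).*2.-1)`!%:R) :> C.
        rewrite -(@bin_fact n.*2 k.*2.+1); last by lia.
        have -> : (n.*2 - k.*2.+1 = (n - k).*2.-1)%N by lia.
        have := fN k.*2.+1; have := fN (n - k).*2.-1.
        move: (k.*2.+1)`! ((n - k).*2.-1)`! => u v u0 v0.
        by rewrite !natrM -mulrA mulfV ?mulr1 // mulf_neq0.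
      by ring.
    by apply: eq_bigr => j _; rewrite /g lift0 /=; case: odd.
  rewrite (reindex_inj rev_ord_inj) /=; apply: eq_bigr => j _.
  have jn : (j <= n.*2)%N by rewrite -ltnS.
  rewrite /g subSS bin_sub // oddB // odd_double /=.
  by rewrite -[(-1) ^+ j]signr_odd; case: odd; rewrite ?expr1 ?expr0; ring.
have f0 := fN n.*2; have n2 : 2 != 0 :> C by rewrite pnatr_eq0.
apply: (mulfI (mulf_neq0 n2 f0)); rewrite key factS natrM.
have a0 : n.*2.+1%:R != 0 :> C by rewrite pnatr_eq0.
by move: f0 a0; move: (n.*2`!%:R : C) (n.*2.+1%:R : C) => f b f0 b0; field; rewrite f0 b0.
Qed.

End ZetaValues.

Theorem mainTheorem4 (R : realType) (zeta : R[i] -> R[i])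
    (hzeta : is_riemann_zeta zeta) :
  [/\ is_proj_line (proj_family (@F1 R)) /\
        proj_family (@F1 R) `<=` proj_set (A_ zeta c0),
      is_proj_line (proj_family (@F2 R)) /\
        proj_family (@F2 R) `<=` proj_set (A_ zeta c0)
    & forall alpha beta : R[i],
        A_ zeta c0 (F1 alpha beta) /\ A_ zeta c0 (F2 alpha beta)].
Proof.
have rec := zeta_recurrence hzeta.
have m1 := F1_mem rec; have m2 := F2_mem rec.
split; last by [].
- by split; [exact: proj_line_F1 | exact: proj_family_sub].
- by split; [exact: proj_line_F2 | exact: proj_family_sub].
Qed.
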